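(* Let $X_i=\theta_i+\varepsilon_i$, $i=1,\dots,n$, with $\varepsilon_i$ i.i.d. $N(0,1)$. Assume that as $n\to\infty$, $s_n\to\infty$, $n/s_n\to\infty$, $\alpha_n\to0$ and $\log(1/\alpha_n)=o\{\sqrt{\log(n/s_n)}\}$. Fix $b\in\mathbb R$. Then the GBS procedure $\varphi^{\mathrm{GBS}}$ at nominal level $\alpha_n$ satisfies $$\sup_{\theta\in\Theta_b}\frac1{s_n}\mathbb E_\theta\{V(\theta,\varphi^{\mathrm{GBS}})+T(\theta,\varphi^{\mathrm{GBS}})\}\le\bar\Phi(b)+o(1),$$ and consequently $$\sup_{\theta\in\Theta_b}\frac1{s_n}\mathbb E_\theta\{V(\theta,\varphi^{\mathrm{GBS}})+T(\theta,\varphi^{\mathrm{GBS}})\}=\mathcal R_H(\Theta_b)+o(1)=\bar\Phi(b)+o(1),$$ that is, the GBS procedure is sharply asymptotically minimax under normalized Hamming loss.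
   Context: Here $(s_n)$ is a sequence of positive integers with $s_n\le n$ and $\alpha_n\in(0,1)$. $\Phi$ is the standard normal distribution function and $\bar\Phi=1-\Phi$. For $\theta\in\mathbb R^n$, $S_\theta=\{i:\theta_i\ne0\}$. The beta-min class is $$\Theta_b=\{\theta\in\mathbb R^n:|S_\theta|=s_n,\ |\theta_i|\ge\sqrt{2\log(n/s_n)}+b\ \text{for all } i\in S_\theta\}.$$ One tests $H_{0i}:\theta_i=0$ versus $H_{1i}:\theta_i\ne0$, $i=1,\dots,n$. A multiple testing procedure is a (measurable) function $\varphi=(\varphi_1,\dots,\varphi_n)\in\{0,1\}^n$ of the data $X=(X_1,\dots,X_n)$, with $\varphi_i=1$ meaning that $H_{0i}$ is rejected. Put $V(\theta,\varphi)=\sum_{i:\theta_i=0}\varphi_i$ and $T(\theta,\varphi)=\sum_{i:\theta_i\ne0}(1-\varphi_i)$. The minimax normalized Hamming risk is $$\mathcal R_H(\Theta_b)=\inf_\varphi\sup_{\theta\in\Theta_b}\frac1{s_n}\mathbb E_\theta\{V(\theta,\varphi)+T(\theta,\varphi)\},$$ the infimum being over all multiple testing procedures. GBS (Gavrilov--Benjamini--Sarkar) step-down procedure: let $P_i=2\bar\Phi(|X_i|)$, with ordered values $P_{(1)}\le\dots\le P_{(n)}$, and $c_j=\dfrac{j\alpha_n}{n+1-j(1-\alpha_n)}$, $j=1,\dots,n$. Let $R_n^{\mathrm{GBS}}=\max\{r:P_{(j)}\le c_j\text{ for every }1\le j\le r\}$ ($=0$ if the set is empty). $\varphi^{\mathrm{GBS}}$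 rejects exactly the hypotheses corresponding to $P_{(1)},\dots,P_{(R_n^{\mathrm{GBS}})}$. *)

(* Defs.v *)
From HB Require Import structures.
From mathcomp Require Import all_boot all_order all_algebra.
From mathcomp Require Import all_classical all_reals all_analysis.

Set Implicit Arguments.
Unset Strict Implicit.
Unset Printing Implicit Defensive.

Import Order.TTheory GRing.Theory Num.Theory.
Import numFieldNormedType.Exports.

Local Open Scope classical_set_scope.
Local Open Scope ring_scope.

Definition std_normal_cdf (R : realType) (x : R) : R :=
  fine (normal_prob (0 : R) 1 `]-oo, x]).

Definition std_normal_tail (R : realType) (x : R) : R := 1 - std_normal_cdf x.

Definition independent_RVs d (T : measurableType d) (R : realType)
    (P : probability T R) (n : nat) (Y : 'I_n -> {RV P >-> R}) : Prop :=
  forall (J : {set 'I_n}) (A : 'I_n -> set R),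
    (forall i, measurable (A i)) ->
    P [set w | forall i, i \in J -> A i (Y i w)] =
    (\prod_(i in J) P (Y i @^-1` A i))%E.

Definition iid_std_normal d (T : measurableType d) (R : realType)
    (P : probability T R) (n : nat) (eps : 'I_n -> {RV P >-> R}) : Prop :=
  independent_RVs eps /\
  forall i (A : set R), measurable A ->
    distribution P (eps i) A = normal_prob (0 : R) 1 A.

Definition observation (T : Type) (R : realType) (n : nat)
    (eps : 'I_n -> T -> R) (theta : n.-tuple R) (w : T) : n.-tuple R :=
  [tuple tnth theta i + eps i w | i < n].

Definition nonnull (R : realType) (n : nat) (theta : n.-tuple R) : {set 'I_n} :=
  [set i | tnth theta i != 0]%SET.

Definition beta_min_class (R : realType) (n s : nat) (b : R) :
    set (n.-tuple R) :=
  [set theta | #|nonnull theta| = s /\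
    forall i, i \in nonnull theta ->
      Num.sqrt (2 * ln (n%:R / s%:R)) + b <= `|tnth theta i|].

(* Measurability is not part of this type: it is imposed on the procedures
   over which [minimax_risk] takes its infimum. *)
Definition procedure (R : realType) (n : nat) := n.-tuple R -> n.-tuple bool.

Definition false_positives (R : realType) (n : nat)
    (theta : n.-tuple R) (rej : n.-tuple bool) : nat :=
  (\sum_(i | i \notin nonnull theta) tnth rej i)%N.

Definition false_negatives (R : realType) (n : nat)
    (theta : n.-tuple R) (rej : n.-tuple bool) : nat :=
  (\sum_(i in nonnull theta) ~~ tnth rej i)%N.

Definition hamming_risk d (T : measurableType d) (R : realType)
    (P : probability T R) (n : nat) (eps : 'I_n -> T -> R) (s : nat)
    (phi : procedure R n) (theta : n.-tuple R) : \bar R :=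
  ((s%:R^-1)%:E * 'E_P[fun w => let rej := phi (observation eps theta w) in
     (false_positives theta rej + false_negatives theta rej)%N%:R])%E.

Definition sup_risk d (T : measurableType d) (R : realType)
    (P : probability T R) (n : nat) (eps : 'I_n -> T -> R) (s : nat) (b : R)
    (phi : procedure R n) : \bar R :=
  ereal_sup [set hamming_risk P eps s phi theta | theta in @beta_min_class R n s b].

Definition minimax_risk d (T : measurableType d) (R : realType)
    (P : probability T R) (n : nat) (eps : 'I_n -> T -> R) (s : nat) (b : R) :
    \bar R :=
  ereal_inf [set sup_risk P eps s b phi |
    phi in [set phi : procedure R n | measurable_fun [set: n.-tuple R] phi]].

Definition pvalue (R : realType) (n : nat) (x : n.-tuple R) (i : 'I_n) : R :=
  2 * std_normal_tail `|tnth x i|.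

(* [nth 0 (ordered_pvalues x) j.-1] is the j-th smallest p-value. *)
Definition ordered_pvalues (R : realType) (n : nat) (x : n.-tuple R) : seq R :=
  sort <=%R [seq pvalue x i | i <- enum 'I_n].

Definition gbs_critical (R : realType) (n : nat) (alpha : R) (j : nat) : R :=
  j%:R * alpha / (n%:R + 1 - j%:R * (1 - alpha)).

Definition gbs_count (R : realType) (n : nat) (alpha : R) (x : n.-tuple R) : nat :=
  (\max_(r < n.+1 | [forall j : 'I_n, (j < r)%N ==>
      (nth 0 (ordered_pvalues x) j <= gbs_critical n alpha j.+1)%R]) r)%N.

(* Ties are harmless: the critical values increase with j, so the p-values
   equal to the last rejected one are all among the first [gbs_count]. *)
Definition gbs (R : realType) (n : nat) (alpha : R) : procedure R n :=
  fun x => [tuple pvalue x i \in take (gbs_count alpha x) (ordered_pvalues x)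
           | i < n].

(* u_n <= v_n + o(1) and u_n = v_n + o(1), the o(1) term being real-valued. *)
Definition le_up_to_o1 (R : realType) (u v : nat -> \bar R) : Prop :=
  exists2 r : nat -> R, r @ \oo --> (0 : R) &
    \forall n \near \oo, (u n <= v n + (r n)%:E)%E.

Definition eq_up_to_o1 (R : realType) (u v : nat -> \bar R) : Prop :=
  exists2 r : nat -> R, r @ \oo --> (0 : R) &
    \forall n \near \oo, u n = (v n + (r n)%:E)%E.

(* Main.v *)
From HB Require Import structures.
Require Import Defs.
From mathcomp Require Import all_boot all_order all_algebra.
From mathcomp Require Import all_classical all_reals all_analysis.
From mathcomp Require Import measurable_realfun ring lra.
Import Order.TTheory GRing.Theory Num.Theory.
Import numFieldNormedType.Exports.
Local Open Scope classical_set_scope.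
Local Open Scope ring_scope.

(** Put a = sqrt (2 log (n / s)), so that n exp (- a^2 / 2) = s: up to
    lower-order factors, as many noises exceed a as there are signals.  A signal
    of size a + b is observed below a with probability T(b), the upper tail of
    the normal law at b.  The theorem says that this loss is unavoidable, and that it is
    all that the step-down procedure loses.

    False rejections of GBS.  Replace the i-th observation by 0, that is, the
    i-th p-value by 1, and let r be the number of rejections then.  The i-th
    hypothesis is rejected only if its p-value is at most c_(r+1), and
    otherwise the procedure makes r rejections ([gbs_leave_one_out]).  Under the
    null the p-value is independent of r and superuniform, so the probability
    of a rejection is at most the odds c_(r+1) / (1 - c_(r+1)) =
    (r + 1) alpha / (n - r) times that of no rejection.  These odds are made so
    that summing over the nulls, of which at most n - r are retained, gives
    E V <= alpha E (R + 1) <= alpha (E V + s + 1)  ([gbs_false_positives]);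
    hence E V = O(alpha s).

    Missed signals of GBS.  The procedure reaches rank J as soon as, for
    every j <= J, at least j signals have a p-value at most c_j.  If u is the
    threshold of |X| that belongs to c_j, the expected number of such signals
    is about s T(u - a - b), whereas j is about 2 n T(u) / alpha.  Their ratio is
    alpha exp (a (u - a)) up to lower-order factors, which tends to infinity for
    u >= a + delta because log (1 / alpha) = o(a).  A Chernoff bound for each j
    ([few_successes]) then shows that the procedure reaches with high
    probability a rank J whose threshold is at most a + delta
    ([gbs_detection_levels], [gbs_count_large]); from there on a signal is
    missed with probability at most T(b - delta) ([gbs_miss_le]).

    Lower bound.  Divide the coordinates into s blocks of m = n / s coordinates
    (rounded down), and hide in each block one signal of size a + b at a
    uniform position.  When some noise of the block exceeds the observation of
    the signal, the data are at least as likely with the signal placed there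
    ([swap_means]); a procedure that rejects the true position therefore pays on
    average as many false rejections ([block_error_ge]).  As the largest noise of a block is at least
    a - delta with high probability, each block costs at least
    T(b + delta) - o(1) ([overtaken_prob_ge], [minimax_risk_ge]).

    Since GBS is itself measurable ([measurable_gbs]), its risk is at least the
    minimax risk, and the two bounds squeeze both risks. *)

(** * Densities and image measures *)

Section integral_density.
Context {d} {T : measurableType d} {R : realType}.
Variables (mu nu : {measure set T -> \bar R}) (f : T -> R).
Hypothesis mf : measurable_fun setT f.
Hypothesis f0 : forall x, 0 <= f x.
Hypothesis nuE : forall A, measurable A -> nu A = (\int[mu]_(x in A) (f x)%:E)%E.

Import HBNNSimple.

Let integral_density_nnsfun (h : {nnsfun T >-> R}) (D : set T) :
  measurable D ->
  (\int[nu]_(x in D) (h x)%:E = \int[mu]_(x in D) (h x * f x)%:E)%E.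
Proof.
move=> mD.
under eq_integral do rewrite fimfunE -fsumEFin//.
under [in RHS]eq_integral => x _.
  rewrite fimfunE EFinM -fsumEFin// ge0_mule_fsuml; last first.
    by move=> r; rewrite EFinM nnfun_muleindic_ge0.
  over.
rewrite ge0_integral_fsum//; last 2 first.
- by move=> r; exact/measurable_EFinP/measurable_funM.
- by move=> r x _; rewrite EFinM nnfun_muleindic_ge0.
rewrite ge0_integral_fsum//; last 2 first.
- move=> r; apply: emeasurable_funM.
    exact/measurable_EFinP/measurable_funM.
  exact/measurable_EFinP/measurable_funTS.
- by move=> r x _; rewrite mule_ge0 ?lee_fin// -lee_fin EFinM nnfun_muleindic_ge0.
apply: eq_fsbigr => r; rewrite inE => -[x _ hxr].
have r0 : 0 <= r by rewrite -hxr.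
rewrite integralZl_indic_nnsfun// integral_indic//.
rewrite nuE; last exact: measurableI.
under [in RHS]eq_integral => y _.
  rewrite EFinM -muleA [X in (_ * X)%E]muleC; over.
rewrite [RHS]ge0_integralZl//; last 2 first.
- apply: emeasurable_funM; exact/measurable_EFinP/measurable_funTS.
- by move=> y _; rewrite mule_ge0 ?lee_fin.
congr (_ * _)%E.
rewrite setIC integral_mkcondr; apply: eq_integral => y _.
rewrite patchE indicE; case: ifPn => _; first by rewrite mule1.
by rewrite mule0.
Qed.

(** Clear for simple functions by [nuE]; the general case is monotone
    convergence on both sides. *)
Lemma ge0_integral_density (h : T -> R) (D : set T) :
  measurable D -> measurable_fun setT h -> (forall x, 0 <= h x) ->
  (\int[nu]_(x in D) (h x)%:E = \int[mu]_(x in D) (h x * f x)%:E)%E.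
Proof.
move=> mD mh h0.
have mh' : measurable_fun D (EFin \o h) by exact/measurable_EFinP/measurable_funTS.
pose h_ := nnsfun_approx mD mh'.
have hcvg x : D x -> EFin (h_ n x) @[n --> \oo] --> (h x)%:E.
  by move=> Dx; apply: (cvg_nnsfun_approx mD mh') => // y _; rewrite lee_fin.
transitivity (limn (fun n => \int[nu]_(x in D) (h_ n x)%:E)%E).
  rewrite -monotone_convergence//=.
  - apply: eq_integral => x /[!inE] xD; apply/esym/cvg_lim => //=.
    exact: hcvg.
  - by move=> n; apply: measurableT_comp => //; exact: measurable_funTS.
  - by move=> n x _; rewrite lee_fin.
  - by move=> x _ a b ab; rewrite lee_fin//; exact/lefP/nd_nnsfun_approx.
rewrite [X in limn X](_ : _ = (fun n => \int[mu]_(x in D) (h_ n x * f x)%:E)%E); last first.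
  by apply/funext => n; exact: integral_density_nnsfun.
rewrite -monotone_convergence//=.
- apply: eq_integral => x /[!inE] xD; apply/cvg_lim => //=.
  under eq_fun do rewrite EFinM.
  by rewrite EFinM; apply: cvgeZr => //; exact: hcvg.
- move=> n; apply/measurable_EFinP/measurable_funM; exact: measurable_funTS.
- by move=> n x _; rewrite lee_fin mulr_ge0.
- move=> x _ a b ab; rewrite lee_fin ler_wpM2r//.
  exact/lefP/nd_nnsfun_approx.
Qed.

End integral_density.

(** The measure structure of an image measure depends on a proof that the map is
    measurable; the existential carries the measure together with its
    change-of-variable formula. *)
Lemma pushforward_measureP {d d'} {T : measurableType d} {T' : measurableType d'}
    {R : realType} (mu : {measure set T -> \bar R}) (f : T -> T') :
  measurable_fun setT f ->
  exists2 m : {measure set T' -> \bar R}, m = (fun A => mu (f @^-1` A)) :> (_ -> _) &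
    forall D (h : T' -> \bar R), measurable D -> measurable_fun D h ->
      (forall y, 0 <= h y)%E ->
      (\int[m]_(y in D) h y = \int[mu]_(x in f @^-1` D) h (f x))%E.
Proof.
move=> mf.
exists (measure_function_pushforward__canonical__measure_function_Measure mu mf) => //.
by move=> D h mD mh h0; exact: (ge0_integral_pushforward mf).
Qed.

(** * The standard normal law *)

Section std_normal.
Context {R : realType}.
Local Notation mu := (@lebesgue_measure R).
Local Notation gauss := (@normal_prob R 0 1).
Implicit Types (x y z t : R) (A : set R).

Lemma normal_pdf1E m x :
  normal_pdf m 1 x = normal_peak 1 * expR (- (x - m) ^+ 2 / 2) :> R.
Proof. by rewrite normal_pdfE// /normal_fun expr1n. Qed.

Lemma normal_pdf1_gt0 m x : 0 < normal_pdf m 1 x :> R.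
Proof. by rewrite normal_pdf1E mulr_gt0 ?expR_gt0// normal_peak_gt0. Qed.

Lemma normal_pdf_shift a x :
  normal_pdf a 1 x = expR (a * x - a ^+ 2 / 2) * normal_pdf 0 1 x :> R.
Proof.
rewrite !normal_pdf1E subr0 mulrCA; congr (_ * _); rewrite -expRD.
by congr expR; field.
Qed.

Lemma std_normal_cdfE x : gauss `]-oo, x] = (std_normal_cdf x)%:E.
Proof. by rewrite /std_normal_cdf fineK// fin_num_measure. Qed.

Lemma normal_prob_rayC (m : R) x :
  normal_prob m 1 `]x, +oo[ = (1 - normal_prob m 1 `]-oo, x])%E.
Proof. by rewrite -(@probability_setC _ _ _ (normal_prob m 1))// setCitvl. Qed.

Lemma std_normal_tailE x : gauss `]x, +oo[ = (std_normal_tail x)%:E.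
Proof. by rewrite /std_normal_tail EFinB -std_normal_cdfE normal_prob_rayC. Qed.

Lemma cdf_add_tail x : std_normal_cdf x + std_normal_tail x = 1 :> R.
Proof. by rewrite /std_normal_tail addrC subrK. Qed.

Lemma normal_prob_shift_ray (a x : R) :
  normal_prob 0 1 `]-oo, x - a] = normal_prob a 1 `]-oo, x].
Proof.
rewrite /normal_prob.
pose F := fun y : R => y - a.
have dF : F^`()%classic = cst 1.
  by apply/funext => y; rewrite derive1E deriveB// derive_id derive_cst subr0.
rewrite (@increasing_ge0_integration_by_substitutionNy _ F (normal_pdf 0 1) x).
- apply: eq_integral => y _; rewrite fctE /= dF /= mulr1 /F.
  by rewrite !normal_pdf1E subr0.
- by move=> y z _ _; rewrite /F ltrD2r.
- by rewrite dF => y _; exact: cst_continuous.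
- by rewrite dF; exact: is_cvg_cst.
- by rewrite dF; exact: cvg_cst.
- split; first by move=> y _; exact: derivableB.
  by apply: cvgB; [exact: cvg_at_left_filter|exact: cvg_cst].
- by rewrite /F; exact: cvg_addrr_Ny.
- by apply: continuous_subspaceT => y; exact: continuous_normal_pdf.
- by move=> y _; exact: normal_pdf_ge0.
Qed.

(** Both sides are probability measures, and [normal_prob_shift_ray] compares
    them on rays. *)
Lemma normal_prob_shift (a : R) A : measurable A ->
  normal_prob 0 1 ((fun y => y + a) @^-1` A) = normal_prob a 1 A.
Proof.
move=> mA.
have mshift : @measurable_fun _ _ (measurableTypeR R) (measurableTypeR R) setT (fun y => y + a).
  exact: (@measurable_funD _ (measurableTypeR R)).
have [m1 m1E _] := pushforward_measureP gauss _ mshift.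
pose m2 : {measure set (measurableTypeR R) -> \bar R} := normal_prob a 1.
transitivity (m1 A); first by rewrite m1E.
rewrite -[RHS]/(m2 A).
have GA : (@RGenOInfty.G R).-sigma.-measurable A by rewrite -RGenOInfty.measurableE.
apply: (@g_sigma_algebra_measure_unique _ R (measurableTypeR R) (@RGenOInfty.G R)
  _ (fun k => `](- k%:R), +oo[%classic) _ _ m1 m2 _ _ _ A GA).
- by move=> _ [x ->]; exact: measurable_itv.
- by move=> k; exists (- k%:R).
- rewrite -subTset => z _; exists (Num.truncn `|z|).+1 => //=.
  by rewrite in_itv/= andbT ltrNl (le_lt_trans _ (truncnS_gt _))// ler_normr lexx orbT.
- move=> _ _ [x ->] [y ->]; exists (Num.max x y).
  rewrite set_itvE; apply/seteqP; split => z /=; rewrite !in_itv/= !andbT gt_max.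
    by move=> [-> ->].
  by move=> /andP[].
- move=> _ [x ->]; rewrite m1E.
  have -> : (fun y : R => y + a) @^-1` `]x, +oo[ = `]x - a, +oo[%classic.
    by apply/seteqP; split => z /=; rewrite !in_itv/= !andbT ltrBlDr.
  by rewrite /m2 /= !normal_prob_rayC normal_prob_shift_ray.
- move=> k; rewrite m1E; apply: (@le_lt_trans _ _ 1%E); last exact: ltry.
  apply: probability_le1; rewrite -[X in measurable X]setTI.
  by apply: mshift => //; exact: measurable_itv.
Qed.

(** The likelihood ratio of N(a, 1) to N(0, 1); with [normal_prob_shift] it turns
    a translation of the noise into a reweighting of its law. *)
Lemma normal_prob_tilt (a : R) A : measurable A ->
  normal_prob a 1 A = (\int[gauss]_(x in A) (expR (a * x - a ^+ 2 / 2))%:E)%E.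
Proof.
move=> mA.
rewrite (@ge0_integral_density _ _ _ mu gauss (normal_pdf 0 1))//.
- by apply: eq_integral => x _; rewrite normal_pdf_shift.
- exact: measurable_normal_pdf.
- by move=> x; exact: normal_pdf_ge0.
- apply: measurableT_comp => //; exact: measurable_funB.
Qed.

Lemma normal_prob_set1 (x : R) : gauss [set x] = 0%E.
Proof.
have /null_content_dominatesP := @normal_prob_dominates R 0 1.
by apply; [exact: measurable_set1|exact: lebesgue_measure_set1].
Qed.

Lemma normal_prob_ray_closed x : gauss `[x, +oo[ = (std_normal_tail x)%:E.
Proof.
rewrite -std_normal_tailE -(@setU1itv _ _ _ _ false)// measureU//.
- by rewrite [X in (X + _)%E]normal_prob_set1 add0e.
- by apply/seteqP; split => // y [/= ->]; rewrite in_itv/= ltxx.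
Qed.

Lemma std_normal_cdfN x : std_normal_cdf (- x) = std_normal_tail x :> R.
Proof.
apply: EFin_inj; rewrite -std_normal_cdfE -normal_prob_ray_closed /normal_prob.
rewrite ge0_integration_by_substitutionNy.
- by apply: eq_integral => y _; rewrite /= !normal_pdf1E !subr0 sqrrN.
- by apply: continuous_subspaceT => y; exact: continuous_normal_pdf.
- by move=> y _; exact: normal_pdf_ge0.
Qed.

Lemma std_normal_tailN x : std_normal_tail (- x) = std_normal_cdf x :> R.
Proof. by rewrite -std_normal_cdfN opprK. Qed.

Lemma std_normal_tail_ge0 x : 0 <= std_normal_tail x :> R.
Proof. by rewrite -lee_fin -std_normal_tailE measure_ge0. Qed.

Lemma std_normal_tail_le1 x : std_normal_tail x <= 1 :> R.
Proof. by rewrite -lee_fin -std_normal_tailE probability_le1. Qed.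

Lemma normal_prob_itv x y : x <= y ->
  gauss `]x, y] = (std_normal_tail x - std_normal_tail y)%:E.
Proof.
move=> xy; rewrite EFinB -!std_normal_tailE; apply/eqP.
rewrite -[X in _ == (X - _)%E](_ : gauss (`]x, y] `|` `]y, +oo[) = _); last first.
  by rewrite -itv_bndbnd_setU.
rewrite measureU//; last first.
  apply/seteqP; split => // z [/=]; rewrite !in_itv/= andbT => /andP[_ zy].
  by rewrite ltNge zy.
by rewrite addeK// fin_num_measure.
Qed.

Lemma std_normal_tail_lipschitz x y : x <= y ->
  std_normal_tail x - std_normal_tail y <= normal_peak 1 * (y - x) :> R.
Proof.
move=> xy; rewrite -lee_fin -normal_prob_itv// /normal_prob.
apply: (@le_trans _ _ (\int[mu]_(z in `]x, y]) (normal_peak 1)%:E)%E).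
  apply: ge0_le_integral => //.
  - by move=> z _; rewrite lee_fin normal_pdf_ge0.
  - apply/measurable_EFinP; apply: measurable_funTS; exact: measurable_normal_pdf.
  - by move=> z _; rewrite lee_fin; exact: normal_pdf_ub.
rewrite integral_cst// [X in (_ * X)%E]lebesgue_measure_itv/= lte_fin.
case: ltP => yx; first by rewrite EFinM EFinB.
by rewrite mule0 lee_fin mulr_ge0 ?normal_peak_ge0 ?subr_ge0.
Qed.

Lemma std_normal_tail_sub_ge x y m : x <= y ->
  (forall z, x < z <= y -> m <= normal_pdf 0 1 z) -> 0 <= m ->
  m * (y - x) <= std_normal_tail x - std_normal_tail y :> R.
Proof.
move=> xy hm m0; rewrite -lee_fin -normal_prob_itv// /normal_prob.
apply: (@le_trans _ _ (\int[mu]_(z in `]x, y]) m%:E)%E); last first.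
  apply: ge0_le_integral => //.
  apply/measurable_EFinP; apply: measurable_funTS; exact: measurable_normal_pdf.
rewrite integral_cst// [X in (_ * X)%E]lebesgue_measure_itv/= lte_fin.
case: ltP => yx; first by rewrite EFinM EFinB.
by rewrite mule0 lee_fin mulr_ge0_le0// subr_le0.
Qed.

Lemma std_normal_tail_anti : {homo (@std_normal_tail R) : x y /~ x <= y}.
Proof. by move=> x y xy; rewrite -subr_ge0 -lee_fin -normal_prob_itv// measure_ge0. Qed.

Lemma normal_pdf0_anti y z : 0 <= y <= z -> normal_pdf 0 1 z <= normal_pdf 0 1 y :> R.
Proof.
move=> /andP[y0 yz]; rewrite !normal_pdf1E !subr0 ler_wpM2l ?normal_peak_ge0//.
by rewrite ler_expR ler_pM2r// lerN2 lerXn2r ?nnegrE// (le_trans y0).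
Qed.

Lemma std_normal_tail_lt x y : x < y -> std_normal_tail y < std_normal_tail x :> R.
Proof.
move=> xy; rewrite -subr_gt0; set M := Num.max `|x| `|y|.
apply: (@lt_le_trans _ _ (normal_pdf 0 1 M * (y - x))).
  by rewrite mulr_gt0 ?subr_gt0 ?normal_pdf1_gt0.
apply: std_normal_tail_sub_ge; [exact: ltW| |exact/ltW/normal_pdf1_gt0].
move=> z /andP[xz zy].
have -> : normal_pdf 0 1 z = normal_pdf 0 1 `|z| by rewrite !normal_pdf1E !subr0 real_normK// num_real.
apply: normal_pdf0_anti; rewrite normr_ge0/= /M.
rewrite le_max; case: (lerP 0 z) => z0.
  by rewrite ?(ger0_norm z0) (le_trans zy (ler_norm y)) orbT.
by rewrite ?(ltr0_norm z0) -(normrN x) (le_trans _ (ler_norm _))// lerN2 ltW.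
Qed.

Lemma std_normal_tail_gt0 x : 0 < std_normal_tail x :> R.
Proof.
by apply: le_lt_trans (std_normal_tail_lt x (x + 1) _); rewrite ?std_normal_tail_ge0 ?ltrDl.
Qed.

(** The area of a rectangle under the density.  For a fixed [eta] it loses a
    factor exp (- eta x) against the true tail, which is negligible whenever
    the comparison has a factor exp (delta x) with delta > eta to spare. *)
Lemma std_normal_tail_ge (eta x : R) : 0 <= x -> 0 <= eta ->
  eta * normal_pdf 0 1 (x + eta) <= std_normal_tail x.
Proof.
move=> x0 e0; apply: (@le_trans _ _ (std_normal_tail x - std_normal_tail (x + eta))).
  have -> : eta * normal_pdf 0 1 (x + eta) = normal_pdf 0 1 (x + eta) * (x + eta - x) by ring.
  apply: std_normal_tail_sub_ge; [by rewrite lerDl| |exact: normal_pdf_ge0].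
  by move=> z /andP[xz zy]; apply: normal_pdf0_anti; rewrite zy (le_trans x0 (ltW xz)).
by rewrite gerBl std_normal_tail_ge0.
Qed.

End std_normal.

Section std_normal_tail.
Context {R : realType}.
Local Notation mu := (@lebesgue_measure R).
Local Notation gauss := (@normal_prob R 0 1).
Implicit Types (x y z t : R) (A : set R).

(** Beyond t, the density of N(t, 1) is at least exp (t^2 / 2) times that of
    N(0, 1), and its integral is at most 1. *)
Lemma std_normal_tail_le t : 0 <= t -> std_normal_tail t <= expR (- t ^+ 2 / 2) :> R.
Proof.
move=> t0; rewrite -lee_fin -std_normal_tailE.
apply: (@le_trans _ _ ((expR (- t ^+ 2 / 2))%:E * normal_prob t 1 `]t, +oo[)%E); last first.
  by rewrite -[leRHS]mule1 lee_wpmul2l ?lee_fin ?expR_ge0// probability_le1.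
rewrite /normal_prob -ge0_integralZl//; last 2 first.
- apply/measurable_EFinP; apply: measurable_funTS; exact: measurable_normal_pdf.
- by move=> x _; rewrite lee_fin normal_pdf_ge0.
apply: ge0_le_integral => //.
- by move=> x _; rewrite lee_fin normal_pdf_ge0.
- apply/measurable_EFinP; apply: measurable_funTS; exact: measurable_normal_pdf.
- apply/measurable_EFinP; apply: measurable_funTS; apply: measurable_funM => //.
  exact: measurable_normal_pdf.
move=> x; rewrite /= in_itv/= andbT => tx.
rewrite -EFinM lee_fin [in leRHS]normal_pdf_shift mulrA -expRD ler_peMl ?normal_pdf_ge0//.
rewrite -[leLHS]expR0 ler_expR.
have ttx : t * t <= t * x by rewrite ler_wpM2l// ltW.
rewrite expr2; lra.
Qed.

Lemma std_normal_tail_continuous : continuous (@std_normal_tail R).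
Proof.
move=> x; apply/cvgrPdist_le => e e0.
have pk : 0 < normal_peak 1 :> R by exact: normal_peak_gt0.
have lip u v : u <= v ->
    `|std_normal_tail u - std_normal_tail v| <= normal_peak 1 * `|v - u| :> R.
  move=> uv; rewrite !ger0_norm ?subr_ge0 ?std_normal_tail_anti//.
  exact: std_normal_tail_lipschitz.
near=> y.
have : `|y - x| <= e / normal_peak 1.
  by near: y; apply: cvgr_distC_le; [exact: cvg_id|exact: divr_gt0].
rewrite ler_pdivlMr// mulrC; apply: le_trans.
have [xy|/ltW yx] := leP x y; first exact: lip.
by rewrite distrC (distrC y); exact: lip.
Unshelve. all: end_near. Qed.

Lemma std_normal_tail0 : std_normal_tail 0 = 2^-1 :> R.
Proof.
have := @cdf_add_tail R 0; have := @std_normal_tailN R 0; rewrite oppr0 => ->; lra.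
Qed.

(** A two-sided p-value is uniform under the null; the inequality is what
    controls false rejections. *)
Lemma pvalue_superuniform (c : R) : 0 < c < 1 ->
  (gauss [set z : R | (2 * std_normal_tail `|z| <= c)%R] <= c%:E)%E.
Proof.
move=> /andP[c0 c1].
pose M := Num.sqrt (2 * ln (2 / c)).
have M0 : 0 <= M by exact: sqrtr_ge0.
have lnc : 0 <= ln (2 / c) by rewrite ln_ge0// ler_pdivlMr//; lra.
have tM : std_normal_tail M <= c / 2.
  apply: (le_trans (std_normal_tail_le _ M0)).
  rewrite /M sqr_sqrtr ?mulr_ge0// mulNr mulrAC divff// mul1r expRN lnK ?posrE ?divr_gt0//.
  by rewrite invf_div.
(* the level t whose p-value is exactly c *)
have [t /andP[t0 _] tE] : exists2 t, 0 <= t <= M & std_normal_tail t = c / 2.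
  have [||t] := @IVT R (@std_normal_tail R) 0 M (c / 2) M0.
  - by apply: continuous_subspaceT; exact: std_normal_tail_continuous.
  - rewrite std_normal_tail0 ge_min le_max tM orbT/=.
    apply/orP; left; lra.
  - by rewrite in_itv/=; exists t.
rewrite [X in normal_prob _ _ X](_ : _ = `]-oo, - t] `|` `[t, +oo[); last first.
  apply/seteqP; split => z /=; rewrite !in_itv/= ?andbT.
    move=> zc; have tz : t <= `|z|.
      by rewrite leNgt; apply/negP => /std_normal_tail_lt; rewrite tE; lra.
    by move: tz; rewrite ler_normr lerNr => /orP[tz|tz]; [right|left].
  move=> tz; have {}tz : t <= `|z|.
    by rewrite ler_normr lerNr; case: tz => ->; rewrite ?orbT.
  by have := std_normal_tail_anti _ _ tz; rewrite tE; lra.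
apply: (@le_trans _ _ (gauss `]-oo, (- t)%R]%classic + gauss `[t, +oo[%classic)%E).
  exact: measureU2.
rewrite normal_prob_ray_closed std_normal_cdfE.
by rewrite std_normal_cdfN -EFinD lee_fin tE -splitr.
Qed.

End std_normal_tail.

(** * Laws on tuples *)

Section density_measure.
Context {d} {T : measurableType d} {R : realType}.
Variables (mu : {measure set T -> \bar R}) (g : T -> R).
Hypothesis mg : measurable_fun setT g.
Hypothesis g0 : forall x, 0 <= g x.

Definition density_measure (A : set T) : \bar R := (\int[mu]_(x in A) (g x)%:E)%E.

Let density0 : density_measure set0 = 0%E.
Proof. by rewrite /density_measure integral_set0. Qed.

Let density_ge0 A : (0 <= density_measure A)%E.
Proof. by apply: integral_ge0 => x _; rewrite lee_fin. Qed.

Let density_sigma_additive : semi_sigma_additive density_measure.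
Proof.
move=> F mF tF mUF; rewrite /density_measure ge0_integral_bigcup//=.
- apply: is_cvg_ereal_nneg_natsum => n _; exact: density_ge0.
- apply/measurable_EFinP; exact: measurable_funTS.
- by move=> x _; rewrite lee_fin.
Qed.

Lemma density_measureP :
  exists m : {measure set T -> \bar R}, m = density_measure :> (_ -> _).
Proof.
pose mx := isMeasure.Build _ _ _ density_measure density0 density_ge0 density_sigma_additive.
pose m : {measure set T -> \bar R} := HB.pack density_measure mx.
by exists m.
Qed.

End density_measure.

Section tuple_measure.
Context {R : realType} {n : nat}.

Definition box (A : 'I_n -> set R) : set (n.-tuple R) :=
  [set x | forall i, A i (tnth x i)].

Lemma measurable_box A : (forall i, measurable (A i)) -> measurable (box A).
Proof.
move=> mA.
rewrite (_ : box A = \bigcap_i ((@tnth n R ^~ i) @^-1` A i)); last first.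
  by apply/seteqP; split => [x Ax i _|x Ax i]; [exact: Ax|exact: Ax].
apply: fin_bigcap_measurable => [|i _]; first exact: finite_finset.
by rewrite -[X in measurable X]setTI; apply: measurable_tnth.
Qed.

(** Boxes are stable under intersection and generate the measurable sets of
    tuples. *)
Lemma tuple_measure_unique (m1 m2 : {measure set (n.-tuple R) -> \bar R}) :
  (m1 setT < +oo)%E ->
  (forall A, (forall i, measurable (A i)) -> m1 (box A) = m2 (box A)) ->
  forall C, measurable C -> m1 C = m2 C.
Proof.
move=> m1oo m12 C mC.
pose G := [set C | exists2 A : 'I_n -> set R, (forall i, measurable (A i)) & C = box A].
have boxT : box (fun=> setT) = setT by apply/seteqP; split.
apply: (g_sigma_algebra_measure_unique G _ (fun=> setT)) => //.
- move=> _ [A mA ->]; exact: measurable_box.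
- by move=> k; exists (fun=> setT).
- by rewrite bigcup_const//; exists 0%N.
- move=> _ _ [A mA ->] [B mB ->]; exists (fun i => A i `&` B i).
    by move=> i; exact: measurableI.
  by apply/seteqP; split => [x [Ax Bx] i|x ABx]; [split|split=> i; case: (ABx i)].
- by move=> _ [A mA ->]; exact: m12.
- move: C mC; apply: smallest_sub; first exact: smallest_sigma_algebra.
  move=> X /=; rewrite -bigcup_seq => -[i _ [B mB <-]].
  apply: sub_sigma_algebra; exists (fun k => if k == i then B else setT).
    by move=> k; case: ifP.
  apply/seteqP; split => [x [_ Bx] k|x Bx].
    by case: eqP => // ->.
  by split => //; have := Bx i; rewrite eqxx.
Qed.

End tuple_measure.

(** * Independence and changes of mean *)

Definition set_coord {R : realType} {n : nat} (i : 'I_n) (v : R) (x : n.-tuple R) : n.-tuple R :=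
  [tuple if k == i then v else tnth x k | k < n].

Lemma tnth_set_coord {R : realType} {n : nat} (i k : 'I_n) (v : R) (x : n.-tuple R) :
  tnth (set_coord i v x) k = if k == i then v else tnth x k.
Proof. by rewrite tnth_mktuple. Qed.

Lemma measurable_set_coord {R : realType} {n : nat} (i : 'I_n) (v : R) :
  measurable_fun setT (set_coord i v).
Proof.
apply/measurable_fun_tnthP => k.
rewrite (_ : _ \o _ = if k == i then cst v else (@tnth n R ^~ k)); last first.
  by apply/funext => x /=; rewrite tnth_set_coord; case: ifP.
by case: ifP => _; [exact: measurable_cst|exact: measurable_tnth].
Qed.

Section observations.
Context {d} {T : measurableType d} {R : realType} {P : probability T R} {n : nat}.
Variable eps : 'I_n -> {RV P >-> R}.
Hypothesis heps : iid_std_normal eps.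
Local Notation gauss := (@normal_prob R 0 1).
Local Notation obs := (@observation T R n (fun i => eps i)).
Implicit Types (theta : n.-tuple R) (i j k : 'I_n).

Lemma tnth_observation theta w i : tnth (obs theta w) i = tnth theta i + eps i w.
Proof. by rewrite tnth_mktuple. Qed.

Lemma measurable_eps i : measurable_fun setT (eps i).
Proof. exact: measurable_funPT. Qed.

Lemma measurable_eps_preimage i (A : set R) : measurable A -> measurable (eps i @^-1` A).
Proof. by move=> mA; rewrite -[X in measurable X]setTI; exact: measurable_eps. Qed.

Lemma measurable_observation theta : measurable_fun setT (obs theta).
Proof.
apply/measurable_fun_tnthP => i.
rewrite (_ : _ \o _ = (fun w => tnth theta i + eps i w)); last first.
  by apply/funext => w /=; rewrite tnth_observation.
by apply: measurable_funD => //; exact: measurable_eps.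
Qed.

Lemma measurable_obs_preimage theta (C : set (n.-tuple R)) :
  measurable C -> measurable (obs theta @^-1` C).
Proof. by move=> mC; rewrite -[X in measurable X]setTI; exact: measurable_observation. Qed.

Lemma eps_law i (A : set R) : measurable A -> P (eps i @^-1` A) = gauss A.
Proof. by move=> mA; exact: heps.2. Qed.

Lemma eps_box_in (J : {set 'I_n}) (A : 'I_n -> set R) : (forall i, measurable (A i)) ->
  P [set w | forall i, i \in J -> A i (eps i w)] = (\prod_(i in J) gauss (A i))%E.
Proof.
by move=> mA; rewrite heps.1//; apply: eq_bigr => i _; rewrite eps_law.
Qed.

Lemma eps_box (A : 'I_n -> set R) : (forall i, measurable (A i)) ->
  P [set w | forall i, A i (eps i w)] = (\prod_i gauss (A i))%E.
Proof.
move=> mA; have := eps_box_in [set: 'I_n]%SET A mA; under eq_bigl do rewrite inE.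
move=> <-; congr (P _); apply/seteqP; by split=> w Aw i *; apply: Aw; rewrite ?inE.
Qed.

(** The factor of a box event that does not involve the [i]-th noise. *)
Let off (i : 'I_n) (A : 'I_n -> set R) := [set w | forall k, k \in [set~ i]%SET -> A k (eps k w)].

Let off_and i A B : (forall k, measurable (A k)) -> measurable B ->
  P (eps i @^-1` B `&` off i A) = (gauss B * P (off i A))%E.
Proof.
move=> mA mB; rewrite /off eps_box_in//.
have mA' k : measurable (if k == i then B else A k) by case: ifP.
transitivity (\prod_k gauss (if k == i then B else A k))%E.
  rewrite -eps_box//; congr (P _); apply/seteqP; split => [w [Bw Aw] k|w Aw].
    by case: eqP => [->//|/eqP ki]; apply: Aw; rewrite !inE.
  split; first by have := Aw i; rewrite eqxx.
  by move=> k; rewrite !inE => /negPf ki; have := Aw k; rewrite ki.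
rewrite (bigD1 i)//= eqxx; congr (_ * _)%E.
by apply: eq_big => k; [rewrite !inE|move=> /negPf ->].
Qed.


Let measurable_off i A : (forall k, measurable (A k)) -> measurable (off i A).
Proof.
move=> mA; rewrite (_ : off i A = \bigcap_(k in [set k | k != i]) (eps k @^-1` A k)).
  apply: fin_bigcap_measurable => [|k _]; first exact: finite_finset.
  exact: measurable_eps_preimage.
by apply/seteqP; split => w Aw k; have := Aw k; rewrite !inE.
Qed.

(** The hypothesis of independence concerns boxes only.  As measures of [C] the
    two sides agree on boxes, hence everywhere. *)
Lemma indep_coord i theta (B : set R) (C : set (n.-tuple R)) : measurable B -> measurable C ->
  P (eps i @^-1` B `&` (set_coord i 0 \o obs theta) @^-1` C) =
  (P (eps i @^-1` B) * P ((set_coord i 0 \o obs theta) @^-1` C))%E.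
Proof.
move=> mB mC; set f := set_coord i 0 \o obs theta.
have mf : measurable_fun setT f.
  by apply: measurableT_comp; [exact: measurable_set_coord|exact: measurable_observation].
have mE := measurable_eps_preimage i B mB.
have [m1 m1E _] := pushforward_measureP (mrestr P mE) f mf.
have p0 : 0 <= fine (P (eps i @^-1` B)) by rewrite fine_ge0.
have [m2 m2E _] := pushforward_measureP (mscale (NngNum p0) P) f mf.
have m12 : m1 C = m2 C.
  apply: tuple_measure_unique => //.
  - rewrite m1E /= /mrestr preimage_setT setTI (@le_lt_trans _ _ 1%E) ?ltry// probability_le1//.
  - move=> A mA; rewrite m1E m2E /= /mscale /mrestr fineK ?fin_num_measure//.
    pose A' k := [set y | A k (tnth theta k + y)].
    have mA' k : measurable (A' k).
      rewrite -[X in measurable X]setTI; apply: (_ : measurable_fun setT (fun y => tnth theta k + y)) => //.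
      exact: measurable_funD.
    have fbox w : box A (f w) <-> A i 0 /\ off i A' w.
      split=> [Aw|[A0 Aw] k].
        split; first by have := Aw i; rewrite tnth_set_coord eqxx.
        move=> k; rewrite !inE => /negPf ki.
        by have := Aw k; rewrite tnth_set_coord ki tnth_observation.
      rewrite tnth_set_coord; case: eqP => [->//|/eqP ki].
      by rewrite tnth_observation; apply: Aw; rewrite !inE.
    have [A0|A0] := pselect (A i 0); last first.
      have -> : f @^-1` box A = set0 by apply/seteqP; split => // w /fbox[].
      by rewrite set0I !measure0 mule0.
    have -> : f @^-1` box A = off i A'.
      by apply/seteqP; split => w; [move=> /fbox[]|move=> ?; apply/fbox].
    by rewrite setIC off_and// eps_law.
by have := m12; rewrite m1E m2E /= /mscale /mrestr fineK ?fin_num_measure// setIC.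
Qed.

(** Again two measures of [C] compared on boxes, where independence reduces the
    claim to the one-dimensional identities [normal_prob_shift] and
    [normal_prob_tilt]. *)
Lemma change_of_mean i theta (a : R) (C : set (n.-tuple R)) : measurable C ->
  P (obs (set_coord i (tnth theta i + a) theta) @^-1` C) =
  (\int[P]_(w in obs theta @^-1` C) (expR (a * eps i w - a ^+ 2 / 2))%:E)%E.
Proof.
move=> mC; pose g (y : R) := expR (a * y - a ^+ 2 / 2).
have mg : measurable_fun [set: R] g.
  by apply: measurableT_comp => //; apply: measurable_funB => //; exact: measurable_funM.
have mgi : measurable_fun setT (g \o eps i) by apply: measurableT_comp => //; exact: measurable_eps.
have [m1 m1E _] := pushforward_measureP P _ (measurable_observation (set_coord i (tnth theta i + a) theta)).
have [nu nuE] := density_measureP P (g \o eps i) mgi (fun w => expR_ge0 _).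
have [m2 m2E _] := pushforward_measureP nu _ (measurable_observation theta).
have m12 : m1 C = m2 C.
  apply: tuple_measure_unique => //.
  - by rewrite m1E preimage_setT (@le_lt_trans _ _ 1%E) ?ltry// probability_le1.
  - move=> A mA; rewrite m1E m2E nuE /density_measure.
    pose A' k := [set y | A k (tnth theta k + y)].
    have mA' k : measurable (A' k).
      rewrite -[X in measurable X]setTI; apply: (_ : measurable_fun setT (fun y => tnth theta k + y)) => //.
      exact: measurable_funD.
    have mE := measurable_off i A' mA'.
    have -> : obs (set_coord i (tnth theta i + a) theta) @^-1` box A =
      eps i @^-1` ((fun y => y + a) @^-1` A' i) `&` off i A'.
      apply/seteqP; split => [w Aw|w [Aiw Aw] k].
        split; first by have := Aw i; rewrite tnth_observation tnth_set_coord eqxx /= /A'/= -addrA (addrC a).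
        move=> k; rewrite !inE => /negPf ki.
        by have := Aw k; rewrite tnth_observation tnth_set_coord ki.
      rewrite tnth_observation tnth_set_coord; case: eqP => [->|/eqP ki].
        by rewrite -addrA (addrC a).
      by apply: Aw; rewrite !inE.
    have -> : obs theta @^-1` box A = eps i @^-1` A' i `&` off i A'.
      apply/seteqP; split => [w Aw|w [Aiw Aw] k].
        split; first by have := Aw i; rewrite tnth_observation.
        by move=> k _; have := Aw k; rewrite tnth_observation.
      rewrite tnth_observation; case: (eqVneq k i) => [->//|ki].
      by apply: Aw; rewrite !inE.
    have mshift : measurable_fun [set: R] (fun y : R => y + a) by exact: measurable_funD.
    have mB := mshift measurableT _ (mA' i); rewrite setTI in mB.
    transitivity (gauss ((fun y => (y + a)%R) @^-1` A' i) * P (off i A'))%E; first exact: off_and.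
    rewrite normal_prob_shift// normal_prob_tilt//.
    have [k1 k1E k1I] := @pushforward_measureP _ _ T (measurableTypeR R) R (mrestr P mE) (eps i) (measurable_eps i).
    have p0 : 0 <= fine (P (off i A')) by rewrite fine_ge0.
    transitivity (\int[mscale (NngNum p0) (@normal_prob R 0 1)]_(x in A' i) (g x)%:E)%E.
      rewrite ge0_integral_mscale//=.
      - by rewrite fineK ?fin_num_measure// muleC.
      - exact: mA'.
      - exact/measurable_EFinP/measurable_funTS.
      - by move=> x _; rewrite lee_fin expR_ge0.
    transitivity (\int[k1]_(x in A' i) (g x)%:E)%E.
      apply: eq_measure_integral => B mB' _.
      by rewrite k1E /= /mscale /mrestr/= fineK ?fin_num_measure// off_and// muleC.
    rewrite k1I//; last 2 first.
    - exact/measurable_EFinP/measurable_funTS.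
    - by move=> x; rewrite lee_fin expR_ge0.
    rewrite (@ge0_integral_density _ _ _ P (mrestr P mE) \1_(off i A'))//.
    + rewrite integral_mkcondr; apply: eq_integral => w _; rewrite patchE /= indicE.
      by case: ifPn => _; rewrite ?mulr1 ?mulr0.
    + move=> A0 mA0; rewrite integral_indic// /mrestr setIC//.
    + exact: measurable_eps_preimage.
    + by move=> w; exact: expR_ge0.
    + exact: mA'.
by have := m12; rewrite m1E m2E nuE.
Qed.

(** The likelihood ratio of [change_of_mean] increases with the observation, so
    adding the signal to the larger of two null observations rather than to the
    smaller one makes the data more likely. *)
Lemma swap_means i j theta (a : R) (C : set (n.-tuple R)) : measurable C -> 0 <= a ->
  tnth theta i = 0 -> tnth theta j = 0 ->
  (forall x, C x -> tnth x i <= tnth x j) ->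
  (P (obs (set_coord i a theta) @^-1` C) <= P (obs (set_coord j a theta) @^-1` C))%E.
Proof.
move=> mC a0 ti tj Cij.
have := change_of_mean i theta a C mC; rewrite ti add0r => ->.
have := change_of_mean j theta a C mC; rewrite tj add0r => ->.
have mg k : measurable_fun setT (fun w => expR (a * eps k w - a ^+ 2 / 2)).
  apply: measurableT_comp => //; apply: measurable_funB => //; exact: measurable_funM.
apply: ge0_le_integral => //.
- exact: measurable_obs_preimage.
- exact/measurable_EFinP/measurable_funTS.
- exact/measurable_EFinP/measurable_funTS.
move=> w /= /Cij; rewrite !tnth_observation ti tj !add0r => eij.
by rewrite lee_fin ler_expR lerD2r ler_wpM2l.
Qed.

End observations.

(** * The step-down procedure *)

Section gbs_combinatorics.
Context {R : realType} {n : nat}.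
Variable alpha : R.
Hypothesis ha : 0 < alpha < 1.
Implicit Types (x : n.-tuple R) (i k : 'I_n).
Local Notation crit := (gbs_critical n alpha).
Local Notation count x := (gbs_count alpha x).

Let a0 : 0 < alpha. Proof. by case/andP: ha. Qed.
Let a1 : alpha < 1. Proof. by case/andP: ha. Qed.
Let a1' : 0 <= 1 - alpha. Proof. by rewrite subr_ge0 ltW. Qed.
Let a0' : 0 <= alpha. Proof. exact: ltW. Qed.

Let den_gt0 j : (j <= n)%N -> 0 < n%:R + 1 - j%:R * (1 - alpha).
Proof.
move=> jn; have jn' : j%:R <= n%:R :> R by rewrite ler_nat.
have : j%:R * (1 - alpha) <= j%:R * 1 :> R by rewrite ler_wpM2l// gerBl.
lra.
Qed.

Lemma gbs_critical_gt0 j : (0 < j <= n)%N -> 0 < crit j.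
Proof.
by move=> /andP[j0 jn]; rewrite /gbs_critical divr_gt0 ?den_gt0// mulr_gt0 ?ltr0n.
Qed.

Lemma gbs_critical_lt1 j : (j <= n)%N -> crit j < 1.
Proof.
move=> jn; rewrite /gbs_critical ltr_pdivrMr ?den_gt0// mul1r.
have : j%:R <= n%:R :> R by rewrite ler_nat.
lra.
Qed.

Lemma gbs_critical_mono (j k : nat) : (j <= k <= n)%N -> crit j <= crit k.
Proof.
move=> /andP[jk kn]; have jn := leq_trans jk kn.
have jk' : j%:R <= k%:R :> R by rewrite ler_nat.
rewrite /gbs_critical ler_pM ?invr_ge0 ?(ltW (den_gt0 _ jn))//.
- by rewrite mulr_ge0.
- by rewrite ler_wpM2r.
- rewrite lef_pV2 ?posrE ?den_gt0//.
  have : j%:R * (1 - alpha) <= k%:R * (1 - alpha) by rewrite ler_wpM2r.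
  lra.
Qed.

Lemma gbs_critical_ge j : (j <= n)%N -> j%:R * alpha / (n%:R + 1) <= crit j.
Proof.
move=> jn; rewrite /gbs_critical ler_wpM2l ?mulr_ge0//.
rewrite lef_pV2 ?posrE ?den_gt0 ?ltr_wpDl//.
have : 0 <= j%:R * (1 - alpha) :> R by rewrite mulr_ge0.
lra.
Qed.

(** The reason for the form of the critical values: their odds are proportional
    to the rank and inversely proportional to the number n - j of hypotheses
    that remain after j rejections. *)
Lemma gbs_critical_odds j : (j < n)%N ->
  crit j.+1 / (1 - crit j.+1) = j.+1%:R * alpha / (n - j)%:R.
Proof.
move=> jn; have := den_gt0 _ jn; rewrite /gbs_critical => /lt0r_neq0 d0.
have nj : (n - j)%:R != 0 :> R by rewrite pnatr_eq0 subn_eq0 -ltnNge.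
have e : 1 - j.+1%:R * alpha / (n%:R + 1 - j.+1%:R * (1 - alpha)) =
    (n - j)%:R / (n%:R + 1 - j.+1%:R * (1 - alpha)).
  by rewrite natrB ?(ltnW jn)// -natr1 in d0 *; field.
by rewrite e; field; rewrite nj /= (addrC 1 j%:R) (natr1 j).
Qed.

Definition hits x (c : R) : nat := #|[set i | pvalue x i <= c]%SET|.

Lemma nth_ordered_pvalues x (c : R) j : (j < n)%N ->
  (nth 0 (ordered_pvalues x) j <= c) = (j < hits x c)%N.
Proof.
move=> jn.
have ss : sorted <=%R (ordered_pvalues x) by apply: sort_sorted; exact: le_total.
have hc : seq.count (<= c) (ordered_pvalues x) = hits x c.
  rewrite /ordered_pvalues count_sort count_map /hits cardE -size_filter.
  rewrite /enum_mem -filter_predI; congr (size _); apply: eq_filter => i /=.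
  by rewrite !inE andbT.
rewrite -hc; apply/idP/idP => [|]; last exact: nth_count_le.
rewrite leNgt; apply: contraR; rewrite -leqNgt => cj.
apply: nth_count_gt => //; rewrite cj/= size_sort size_map size_enum_ord//.
Qed.

Let admissible x (r : 'I_n.+1) := [forall j : 'I_n, (j < r)%N ==>
  (nth 0 (ordered_pvalues x) j <= crit j.+1)%R].

Let admissibleE x (r : 'I_n.+1) :
  admissible x r <-> (forall j, (0 < j <= r)%N -> (j <= hits x (crit j))%N).
Proof.
split=> [/forallP H [//|j] /= jr|H].
  have jn : (j < n)%N by rewrite (leq_trans jr)// -ltnS.
  by have /implyP/(_ jr) := H (Ordinal jn); rewrite nth_ordered_pvalues.
by apply/forallP => j; apply/implyP => jr; rewrite nth_ordered_pvalues// H.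
Qed.

Lemma gbs_count_leq x : (count x <= n)%N.
Proof. by apply/bigmax_leqP => r _; rewrite -ltnS. Qed.

Lemma gbs_count_hits x j : (0 < j <= count x)%N -> (j <= hits x (crit j))%N.
Proof.
have : (0 < #|[pred r : 'I_n.+1 | admissible x r]|)%N.
  by apply/card_gt0P; exists ord0; rewrite inE; apply/forallP.
case/(eq_bigmax_cond (fun r : 'I_n.+1 => r : nat)) => r /admissibleE Ar Er.
suff -> : count x = r by exact: Ar.
by rewrite -Er /gbs_count; apply: eq_bigl => q; rewrite inE.
Qed.

Lemma gbs_count_geq x r : (r <= n)%N ->
  (forall j, (0 < j <= r)%N -> (j <= hits x (crit j))%N) -> (r <= count x)%N.
Proof.
rewrite -ltnS => rn H; rewrite /gbs_count.
apply: (@leq_bigmax_cond _ (admissible x) (fun r : 'I_n.+1 => r : nat) (Ordinal rn)).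
exact/admissibleE.
Qed.

(** A p-value equal to the last rejected one is not left out: the next one
    exceeds a larger critical value. *)
Lemma gbs_rejects x i :
  tnth (gbs alpha x) i = (0 < count x)%N && (pvalue x i <= crit (count x)).
Proof.
rewrite tnth_mktuple; set r := count x.
have ss : sorted <=%R (ordered_pvalues x) by apply: sort_sorted; exact: le_total.
have sz : size (ordered_pvalues x) = n by rewrite size_sort size_map size_enum_ord.
have rn : (r <= n)%N := gbs_count_leq x.
have mem : pvalue x i \in ordered_pvalues x by rewrite mem_sort map_f// mem_enum.
apply/idP/andP => [/(nthP 0)[k]|[r0 pr]].
  rewrite size_take_min sz (minn_idPl rn) => kr; rewrite nth_take// => <-.
  split; first exact: leq_ltn_trans kr.
  have kn := leq_trans kr rn.
  apply: (@le_trans _ _ (crit k.+1)); last by apply: gbs_critical_mono; rewrite kr.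
  by rewrite nth_ordered_pvalues// gbs_count_hits.
have [rn'|nr] := ltnP r n; last by rewrite take_oversize// sz.
move: mem; rewrite -{1}(cat_take_drop r (ordered_pvalues x)) mem_cat => /orP[//|].
move=> /(nthP 0)[k]; rewrite size_drop sz nth_drop => kr pk.
have : crit r.+1 < nth 0 (ordered_pvalues x) r.
  rewrite ltNge nth_ordered_pvalues//; apply/negP => hr.
  have : (r.+1 <= r)%N.
    apply: gbs_count_geq => // j /andP[j0]; rewrite leq_eqVlt => /orP[/eqP ->//|jr].
    by apply: gbs_count_hits; rewrite j0 -ltnS.
  by rewrite ltnn.
rewrite ltNge => /negP[].
have c1 : crit r <= crit r.+1 by apply: gbs_critical_mono; rewrite leqnSn.
apply: le_trans c1; apply: le_trans pr; rewrite -pk.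
apply: sorted_leq_nth => //; rewrite ?inE ?sz ?leq_addr//; [exact: le_trans|].
by rewrite -ltn_subRL.
Qed.

Lemma pvalue_set0 x i k : pvalue (set_coord i 0 x) k = if k == i then 1 else pvalue x k.
Proof.
rewrite /pvalue tnth_set_coord; case: ifP => // _.
by rewrite normr0 std_normal_tail0 divff.
Qed.

Lemma hits_set0 x i (c : R) : c < 1 -> c < pvalue x i -> hits (set_coord i 0 x) c = hits x c.
Proof.
move=> c1 cp; congr #|pred_of_set _|; apply/setP => k; rewrite !inE pvalue_set0.
by case: eqP => [->|//]; rewrite !leNgt c1 cp.
Qed.

Lemma gbs_count_set0_lt x i : (count (set_coord i 0 x) < n)%N.
Proof.
rewrite ltnNge; apply/negP => nc.
have n0 : (0 < n)%N by exact: leq_ltn_trans (ltn_ord i).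
have := gbs_count_hits (set_coord i 0 x) n; rewrite n0 nc => /(_ isT).
rewrite leqNgt => /negP[].
rewrite -[X in (_ < X)%N](card_ord n) -cardsT; apply: proper_card.
rewrite finset.properEneq finset.subsetT andbT; apply/negP => /eqP/setP/(_ i).
by rewrite !inE pvalue_set0 eqxx leNgt gbs_critical_lt1.
Qed.

(** Under the hypothesis on the [i]-th p-value, replacing it by 1 changes none
    of the comparisons with c_1, ..., c_(r+1), and these determine where the
    procedure stops.  So the fate of the [i]-th hypothesis depends on its own
    p-value through one threshold, computed from the other p-values. *)
Lemma gbs_leave_one_out x i : let r := count (set_coord i 0 x) in
  crit r.+1 < pvalue x i -> count x = r /\ ~~ tnth (gbs alpha x) i.
Proof.
move=> r cp; have rn : (r < n)%N := gbs_count_set0_lt x i.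
have hE j : (j <= r.+1)%N -> hits x (crit j) = hits (set_coord i 0 x) (crit j).
  move=> jr; rewrite hits_set0//; first by rewrite gbs_critical_lt1// (leq_trans jr).
  by apply: le_lt_trans cp; rewrite gbs_critical_mono// jr.
have cE : count x = r.
  apply/eqP; rewrite eqn_leq; apply/andP; split; last first.
    apply: gbs_count_geq => [|j /andP[j0 jr]]; first exact: ltnW.
    by rewrite hE ?(leqW jr)// gbs_count_hits// j0.
  rewrite leqNgt; apply/negP => rc.
  have : (r.+1 <= r)%N.
    apply: gbs_count_geq => // j /andP[j0 jr].
    rewrite -hE//; apply: gbs_count_hits.
    by rewrite j0 (leq_trans jr).
  by rewrite ltnn.
split; first exact: cE.
rewrite (gbs_rejects x i) cE negb_and -ltNge; apply/orP; right.
by apply: le_lt_trans cp; apply: gbs_critical_mono; rewrite leqnSn rn.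
Qed.

Lemma card_rejected x : (count x <= \sum_i tnth (gbs alpha x) i)%N.
Proof.
have [->//|c0] := posnP (count x).
apply: (leq_trans (gbs_count_hits x (count x) _)); first by rewrite c0 leqnn.
rewrite /hits -sum1dep_card big_mkcond /=; apply: leq_sum => i _.
by rewrite gbs_rejects c0/=; case: ifP.
Qed.

End gbs_combinatorics.

(** * Real-valued probabilities and finitely-valued statistics *)

Section real_probability.
Context {d} {T : measurableType d} {R : realType} (P : probability T R).
Implicit Types (A B : set T).

Definition prob A : R := fine (P A).

Lemma probE A : measurable A -> P A = (prob A)%:E.
Proof. by move=> mA; rewrite /prob fineK// fin_num_measure. Qed.

Lemma prob_ge0 A : 0 <= prob A.
Proof. by rewrite fine_ge0// measure_ge0. Qed.

Lemma prob_le A B : measurable A -> measurable B -> A `<=` B -> prob A <= prob B.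
Proof.
by move=> mA mB AB; rewrite -lee_fin -!probE// le_measure// inE.
Qed.

Lemma prob_le1 A : measurable A -> prob A <= 1.
Proof. by move=> mA; rewrite -lee_fin -probE// probability_le1. Qed.

Lemma prob_setC A : measurable A -> prob (~` A) = 1 - prob A.
Proof.
move=> mA; apply: EFin_inj; rewrite -probE; last exact: measurableC.
by rewrite probability_setC// probE.
Qed.

Lemma prob_setU_le A B : measurable A -> measurable B ->
  prob (A `|` B) <= prob A + prob B.
Proof.
move=> mA mB; rewrite -lee_fin EFinD -!probE//; last exact: measurableU.
exact: measureU2.
Qed.

Lemma prob_setI_setC A B : measurable A -> measurable B ->
  prob A = prob (A `&` B) + prob (A `&` ~` B).
Proof.
move=> mA mB; apply: EFin_inj; rewrite EFinD -!probE//; last 2 first.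
- by apply: measurableI => //; exact: measurableC.
- exact: measurableI.
by rewrite [X in P X = _](_ : A = A `&` B `|` A `&` ~` B) ?measureU//;
  [exact: measurableI|apply: measurableI => //; exact: measurableC|
   by apply/seteqP; split => // x [[_ ?] [_ ?]]|rewrite -setIUr setUv setIT].
Qed.

Lemma prob_exists_le (I : finType) (Q : pred I) (E : I -> set T) :
  (forall i, measurable (E i)) ->
  prob [set w | exists2 i, Q i & E i w] <= \sum_(i | Q i) prob (E i).
Proof.
move=> mE.
have -> : [set w | exists2 i, Q i & E i w] = \big[setU/set0]_(i | Q i) E i.
  rewrite -bigcup_seq_cond; apply/seteqP; split => w [i Qi Ei]; exists i => //=.
    by rewrite mem_index_enum.
  by case/andP: Qi.
have : measurable (\big[setU/set0]_(i | Q i) E i) /\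
    prob (\big[setU/set0]_(i | Q i) E i) <= \sum_(i | Q i) prob (E i).
  elim/big_rec2: _ => [|i r B Qi [mB Br]]; first by rewrite /prob measure0.
  split; first exact: measurableU.
  by apply: (le_trans (prob_setU_le _ _ _ _)) => //; rewrite lerD2l.
by case.
Qed.

Section finite_law.
Variables (D : finType) (F : T -> D).
Hypothesis mF : forall d, measurable (F @^-1` [set d]).

Lemma measurable_finite_law (Q : pred D) : measurable [set w | Q (F w)].
Proof.
rewrite (_ : [set w | Q (F w)] = \bigcup_(d in [set` Q]) (F @^-1` [set d])).
  by apply: fin_bigcup_measurable => // ; exact: finite_finset.
by apply/seteqP; split => [w Qw|w [e Qe]]; [exists (F w)|by move=> /= ->].
Qed.

(** Turns probabilities of events that depend on finitely many outcomes into
    finite sums, which can then be exchanged without any integral. *)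
Lemma prob_finite_law (Q : pred D) :
  prob [set w | Q (F w)] = \sum_(e | Q e) prob (F @^-1` [set e]).
Proof.
apply: EFin_inj; rewrite -probE; last exact: measurable_finite_law.
rewrite (_ : [set w | Q (F w)] = \bigcup_(d in [set` Q]) (F @^-1` [set d])); last first.
  by apply/seteqP; split => [w Qw|w [e Qe]]; [exists (F w)|by move=> /= ->].
rewrite measure_fin_bigcup//; last first.
  by apply/trivIsetP => i j _ _ ij; apply/seteqP; split => // w [/= Fi Fj]; move: ij; rewrite -Fi -Fj eqxx.
rewrite -(@bigfs _ _ _ _ (index_enum D)) ?index_enum_uniq//; last by move=> i _; rewrite mem_index_enum.
by rewrite -sumEFin; apply: eq_bigr => e _; exact: probE.
Qed.

End finite_law.

End real_probability.

(** Such a set is a finite union, over the admissible answers, of finite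
    intersections of the events that a question gets a given answer. *)
Lemma measurable_determined {d} {T : measurableType d} (K : finType) (b : K -> T -> bool)
    (Q : T -> Prop) :
  (forall k, measurable [set x | b k x]) ->
  (forall x y, (forall k, b k x = b k y) -> Q x -> Q y) ->
  measurable [set x | Q x].
Proof.
move=> mb bQ.
have mb' k c : measurable [set x | b k x = c].
  case: c; first exact: mb.
  rewrite (_ : [set x | _] = ~` [set x | b k x]); first exact: measurableC.
  by apply/seteqP; split => x /=; [move=> ->|move=> /negP/negbTE].
rewrite (_ : [set x | Q x] = \bigcup_(beta in [set beta : {ffun K -> bool} |
    exists2 y, Q y & forall k, b k y = beta k]) \bigcap_k [set x | b k x = beta k]).
  apply: fin_bigcup_measurable => [|beta _]; first exact: finite_finset.
  by apply: fin_bigcap_measurable => //; exact: finite_finset.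
apply/seteqP; split => [x Qx|x [beta [y Qy by_] bx]].
  exists [ffun k => b k x]; last by move=> k _ /=; rewrite ffunE.
  by exists x => // k; rewrite ffunE.
by apply: bQ Qy => k; rewrite by_ bx.
Qed.

(** * Measurability of the procedure *)

Section gbs_measurability.
Context {R : realType} {n : nat}.
Variable alpha : R.
Hypothesis ha : 0 < alpha < 1.

Lemma measurable_two_sided_tail_le (c : R) :
  measurable [set z : R | 2 * std_normal_tail `|z| <= c].
Proof.
have mt : measurable_fun setT (fun z : R => 2 * std_normal_tail `|z|).
  apply: measurable_funM => //; apply: measurableT_comp => //.
  by apply: continuous_measurable_fun; exact: std_normal_tail_continuous.
have := measurable_fun_ler mt (measurable_cst c).
by move=> /(_ measurableT [set true]); rewrite setTI; apply.
Qed.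

Lemma measurable_pvalue_le (i : 'I_n) (c : R) : measurable [set x : n.-tuple R | pvalue x i <= c].
Proof.
have mt := @measurable_tnth _ R n i.
by have := mt measurableT _ (measurable_two_sided_tail_le c); rewrite setTI.
Qed.

(** The procedure sees the data only through these comparisons. *)
Let questions (k : 'I_n * 'I_n.+1) (x : n.-tuple R) := pvalue x k.1 <= gbs_critical n alpha k.2.

Let same_hits (x y : n.-tuple R) : (forall k, questions k x = questions k y) ->
  forall j, (j <= n)%N -> hits x (gbs_critical n alpha j) = hits y (gbs_critical n alpha j).
Proof.
move=> qxy j jn; congr #|pred_of_set _|; apply/setP => i; rewrite !inE.
by rewrite -ltnS in jn; exact: (qxy (i, Ordinal jn)).
Qed.

Let same_count (x y : n.-tuple R) : (forall k, questions k x = questions k y) ->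
  gbs_count alpha x = gbs_count alpha y.
Proof.
have le (x' y' : n.-tuple R) : (forall k, questions k x' = questions k y') ->
    (gbs_count alpha x' <= gbs_count alpha y')%N.
  move=> qxy; apply: gbs_count_geq => [|j jr]; first exact: gbs_count_leq.
  rewrite -(same_hits _ _ qxy); first exact: gbs_count_hits.
  by case/andP: jr => _ /leq_trans; apply; exact: gbs_count_leq.
move=> qxy; apply/eqP; rewrite eqn_leq (le _ _ qxy) /=.
by apply: le => k; rewrite qxy.
Qed.

Let same_gbs (x y : n.-tuple R) i : (forall k, questions k x = questions k y) ->
  tnth (gbs alpha x) i = tnth (gbs alpha y) i.
Proof.
move=> qxy; have c : (gbs_count alpha y < n.+1)%N by rewrite ltnS gbs_count_leq.
have := qxy (i, Ordinal c); rewrite /questions /= => pxy.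
by rewrite (gbs_rejects _ ha x) (gbs_rejects _ ha y) (same_count _ _ qxy) pxy.
Qed.

Lemma measurable_gbs_stat (Q : nat -> n.-tuple bool -> Prop) :
  measurable [set x : n.-tuple R | Q (gbs_count alpha x) (gbs alpha x)].
Proof.
apply: (measurable_determined _ questions) => [k|x y qxy].
  exact: measurable_pvalue_le.
rewrite (same_count _ _ qxy); suff -> : gbs alpha x = gbs alpha y by [].
by apply: eq_from_tnth => i; exact: same_gbs.
Qed.

Lemma measurable_gbs : measurable_fun [set: n.-tuple R] (gbs alpha).
Proof.
apply/measurable_fun_tnthP => i; apply: (measurable_fun_bool true) => //.
rewrite setTI; exact: (measurable_gbs_stat (fun _ v => tnth v i = true)).
Qed.

End gbs_measurability.

(** * False rejections *)

Section false_positives.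
Context {d} {T : measurableType d} {R : realType} {P : probability T R} {n : nat}.
Variable eps : 'I_n -> {RV P >-> R}.
Hypothesis heps : iid_std_normal eps.
Variable alpha : R.
Hypothesis ha : 0 < alpha < 1.
Variable theta : n.-tuple R.
Local Notation obs := (@observation T R n (fun i => eps i) theta).
Local Notation crit := (gbs_critical n alpha).
Local Notation count x := (gbs_count alpha x).
Local Notation outcome := ('I_n.+1 * n.-tuple bool)%type.
Implicit Types (i : 'I_n) (e : outcome).

Definition rejection_prob (phi : procedure R n) i : R :=
  prob P [set w | tnth (phi (obs w)) i].

Let stat (w : T) : outcome := (inord (count (obs w)), gbs alpha (obs w)).
Let law e := prob P (stat @^-1` [set e]).

Let stat1 w : (stat w).1 = count (obs w) :> nat.
Proof. by rewrite /= inordK// ltnS gbs_count_leq. Qed.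

Let measurable_stat e : measurable (stat @^-1` [set e]).
Proof.
rewrite (_ : _ @^-1` _ = obs @^-1` [set x | count x = e.1 /\ gbs alpha x = e.2]).
  apply: measurable_obs_preimage.
  exact: (measurable_gbs_stat _ ha (fun r v => r = e.1 /\ v = e.2)).
apply/seteqP; split => w /=.
  by move=> <-; rewrite stat1.
by case: e => r v /= [cr <-]; congr pair; apply/val_inj; rewrite /= inordK// cr.
Qed.

Let measurable_rejects i : measurable [set w | tnth (gbs alpha (obs w)) i].
Proof.
apply: (measurable_obs_preimage eps theta [set x | tnth (gbs alpha x) i]).
exact: (measurable_gbs_stat _ ha (fun _ v => tnth v i)).
Qed.

(** Given that r hypotheses are rejected once the [i]-th p-value is set to 1, the
    conditional probability p that the [i]-th p-value is at most c_(r+1)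
    satisfies p <= c_(r+1), hence p <= c_(r+1) / (1 - c_(r+1)) (1 - p); and in
    the complementary event the procedure makes exactly r rejections. *)
Let null_rejection_le i : tnth theta i = 0 ->
  rejection_prob (gbs alpha) i <=
  \sum_(r < n) r.+1%:R * alpha / (n - r)%:R *
    \sum_(e : outcome | (e.1 == r :> nat) && ~~ tnth e.2 i) law e.
Proof.
move=> ti0.
pose loo w := set_coord i 0 (obs w).
pose G w : 'I_n := Ordinal (gbs_count_set0_lt _ ha (obs w) i).
pose B (r : 'I_n) := [set z : R | 2 * std_normal_tail `|z| <= crit r.+1].
have mB r : measurable (B r) by exact: measurable_two_sided_tail_le.
pose C (r : 'I_n) := [set x : n.-tuple R | count x = r].
have mC r : measurable (C r) by exact: (measurable_gbs_stat _ ha (fun k _ => k = r)).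
have mEB r := measurable_eps_preimage eps i (B r) (mB r).
have mL r : measurable (loo @^-1` C r).
  rewrite -[X in measurable X]setTI; apply: measurableT_comp => //.
    exact: measurable_set_coord.
  exact: measurable_observation.
have pE w : pvalue (obs w) i = 2 * std_normal_tail `|eps i w|.
  by rewrite /pvalue tnth_observation ti0 add0r.
have indep r : prob P (eps i @^-1` B r `&` loo @^-1` C r) =
    prob P (eps i @^-1` B r) * prob P (loo @^-1` C r).
  rewrite /prob -fineM ?fin_num_measure//; congr fine.
  exact: indep_coord.
apply: (@le_trans _ _ (\sum_(r < n) prob P (eps i @^-1` B r `&` loo @^-1` C r))).
  apply: le_trans (prob_exists_le P _ predT _ _); last by move=> r; exact: measurableI.
  apply: prob_le => //.
    rewrite (_ : [set w | _] = \bigcup_r (eps i @^-1` B r `&` loo @^-1` C r)).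
      apply: fin_bigcup_measurable => [|r _]; [exact: finite_finset|exact: measurableI].
    by apply/seteqP; split => w [r _ ?]; exists r.
  move=> w rej; exists (Ordinal (gbs_count_set0_lt _ ha (obs w) i)) => //; split => //.
  rewrite /B /= -pE leNgt; apply/negP => /(gbs_leave_one_out _ ha)[_].
  by rewrite rej.
apply: ler_sum => r _; rewrite indep.
set pi := prob P (eps i @^-1` B r); set q := prob P (loo @^-1` C r).
set c := crit r.+1; have c1 : c < 1 by exact: gbs_critical_lt1.
have c0 : 0 < c by apply: gbs_critical_gt0 => //=.
have pic : pi <= c.
  rewrite -lee_fin -probE//; apply: (le_trans _ (pvalue_superuniform c _)); last by rewrite c0.
  by rewrite eps_law.
rewrite -gbs_critical_odds//.
(* pi <= c is turned into odds: pi <= c / (1 - c) (1 - pi) *)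
apply: (@le_trans _ _ (c / (1 - c) * ((1 - pi) * q))).
  rewrite mulrA ler_wpM2r ?prob_ge0// mulrAC ler_pdivlMr ?subr_gt0//.
  by rewrite !mulrBr !mulr1 mulrC; lra.
apply: ler_wpM2l; first by rewrite divr_ge0 ?(ltW c0)// subr_ge0 ltW.
have -> : (1 - pi) * q = prob P (loo @^-1` C r `&` ~` (eps i @^-1` B r)).
  have := prob_setI_setC P _ _ (mL r) (mEB r).
  by rewrite setIC indep -/pi -/q; lra.
rewrite -(prob_finite_law P _ _ measurable_stat (fun e => (e.1 == r :> nat) && ~~ tnth e.2 i)).
apply: prob_le.
- by apply: measurableI => //; exact: measurableC.
- exact: (measurable_finite_law _ _ measurable_stat (fun e => (e.1 == r :> nat) && ~~ tnth e.2 i)).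
move=> w [Cw /negP]; rewrite /B /= -pE -ltNge => cp.
have Cw' : count (set_coord i 0 (obs w)) = r by exact: Cw.
have := gbs_leave_one_out _ ha (obs w) i; rewrite /= Cw' => /(_ cp)[cr nrej].
by rewrite -[_ == _]/((stat w).1 == r :> nat) stat1 cr eqxx.
Qed.

Let law_ge0 e : 0 <= law e. Proof. exact: prob_ge0. Qed.

(** Inequalities that hold for every possible outcome may be used under the sum
    over all outcomes, as the others have probability 0. *)
Let law_le e (x y : R) : (forall w, stat w = e -> x <= y) -> x * law e <= y * law e.
Proof.
move=> xy; have [e0|/set0P[w we]] := eqVneq (stat @^-1` [set e]) set0.
  by rewrite /law e0 /prob measure0 !mulr0.
by rewrite ler_wpM2r// (xy w).
Qed.

Let rejection_probE i : rejection_prob (gbs alpha) i = \sum_(e : outcome) (tnth e.2 i)%:R * law e.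
Proof.
rewrite /rejection_prob (prob_finite_law P _ _ measurable_stat (fun e => tnth e.2 i)).
by rewrite big_mkcond; apply: eq_bigr => e _; case: (tnth _ _); rewrite ?mul1r ?mul0r.
Qed.

(** Sum [null_rejection_le] over the nulls and exchange the sums.  When r
    hypotheses are rejected, at most n - r nulls are retained, which cancels the
    denominator and leaves alpha E (R + 1); and R exceeds the number of false
    rejections by at most the number of signals. *)
Lemma gbs_false_positives :
  \sum_(i | i \notin nonnull theta) rejection_prob (gbs alpha) i <=
  alpha * (\sum_(i | i \notin nonnull theta) rejection_prob (gbs alpha) i +
           #|nonnull theta|%:R + 1).
Proof.
set N := [pred i | i \notin nonnull theta].
have card_split w : (\sum_i tnth (stat w).2 i <= \sum_(i in N) tnth (stat w).2 i + #|nonnull theta|)%N.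
  rewrite (bigID (mem N))/= leq_add2l -sum1_card big_mkcond [leqRHS]big_mkcond.
  by apply: leq_sum => i _; rewrite !inE negbK; case: ifP => // _; exact: leq_b1.
apply: (@le_trans _ _ (\sum_(r < n) \sum_(e : outcome | e.1 == r :> nat)
    (r.+1%:R * alpha) * law e)).
  apply: (@le_trans _ _ (\sum_(i in N) \sum_(r < n) r.+1%:R * alpha / (n - r)%:R *
    \sum_(e : outcome | (e.1 == r :> nat) && ~~ tnth e.2 i) law e)).
    apply: ler_sum => i; rewrite !inE negbK => /eqP; exact: null_rejection_le.
  rewrite exchange_big; apply: ler_sum => r _.
  rewrite -mulr_sumr.
  have nr0 : 0 < (n - r)%:R :> R by rewrite ltr0n subn_gt0.
  rewrite -mulr_sumr -mulrA ler_wpM2l ?mulr_ge0 ?(ltW (andP ha).1)//.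
  rewrite ler_pdivrMl// mulr_sumr.
  have -> : \sum_(i in N) \sum_(e : outcome | (e.1 == r :> nat) && ~~ tnth e.2 i) law e =
      \sum_(e : outcome | e.1 == r :> nat) (\sum_(i in N) ~~ tnth e.2 i)%:R * law e.
    under eq_bigr do rewrite big_mkcondr.
    rewrite exchange_big; apply: eq_bigr => e _; rewrite natr_sum mulr_suml.
    by apply: eq_bigr => i _; case: (tnth e.2 i); rewrite ?mul1r ?mul0r.
  apply: ler_sum => e /eqP er; apply: law_le => w we; rewrite ler_nat.
  rewrite leq_subRL; last exact: ltnW.
  apply: (@leq_trans (\sum_i tnth e.2 i + \sum_i ~~ tnth e.2 i)).
    apply: leq_add.
      by rewrite -er -we stat1; exact: card_rejected.
    by rewrite [leqRHS](bigID (mem N)) leq_addr.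
  rewrite -big_split -[leqRHS]card_ord -sum1_card; apply: leq_sum => i _.
  by case: (tnth e.2 i).
have a0 : 0 <= alpha by case/andP: ha => /ltW.
apply: (@le_trans _ _ (\sum_(e : outcome) (e.1.+1%:R * alpha) * law e)).
  rewrite (exchange_big_dep predT)//=; apply: ler_sum => e _.
  have [en|ne] := ltnP e.1 n.
    by rewrite (big_pred1 (Ordinal en))// => r; rewrite eq_sym -val_eqE.
  rewrite big_pred0; first by rewrite !mulr_ge0.
  by move=> r; apply/negP => /eqP er; have := ltn_ord r; rewrite -er ltnNge ne.
apply: (@le_trans _ _ (\sum_(e : outcome)
    (alpha * ((\sum_(i in N) tnth e.2 i)%:R + #|nonnull theta|%:R + 1)) * law e)).
  apply: ler_sum => e _; apply: law_le => w we; rewrite mulrC ler_wpM2l//.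
  rewrite -natr1 lerD2r -natrD ler_nat -we stat1.
  by apply: leq_trans (card_split w); exact: card_rejected.
under eq_bigr do rewrite -mulrA; rewrite -mulr_sumr ler_wpM2l//.
under eq_bigr do rewrite -addrA mulrDl; rewrite big_split/= -mulr_sumr.
have -> : \sum_e law e = 1.
  rewrite -(prob_finite_law P _ _ measurable_stat predT).
  by rewrite /prob [X in P X](_ : _ = setT) ?probability_setT//; apply/seteqP; split.
rewrite mulr1 addrA !lerD2r; under [leRHS]eq_bigr do rewrite rejection_probE.
rewrite exchange_big; apply: ler_sum => e _.
by rewrite natr_sum mulr_suml.
Qed.

End false_positives.

(** * Missed signals *)

Section false_negatives.
Context {d} {T : measurableType d} {R : realType} {P : probability T R} {n : nat}.
Variable eps : 'I_n -> {RV P >-> R}.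
Hypothesis heps : iid_std_normal eps.
Implicit Types (i : 'I_n) (S : {set 'I_n}) (A : 'I_n -> set R).

(** Chernoff's bound with parameter log 2: the indicator of fewer than j
    successes is at most 2^(j - number of successes), whose expectation is a
    product by independence. *)
Lemma few_successes S A (j : nat) : (forall i, measurable (A i)) ->
  prob P [set w | (#|[set i in S | `[< A i (eps i w) >]]%SET| < j)%N] <=
  2 ^+ j * \prod_(i in S) (1 - prob P (eps i @^-1` A i) / 2).
Proof.
move=> mA; pose F w := [ffun i => `[< A i (eps i w) >]].
pose side i (c : bool) := if c then A i else ~` A i.
have mside i c : measurable (side i c) by case: c; [exact: mA|apply: measurableC; exact: mA].
have FE (beta : {ffun 'I_n -> bool}) :
    F @^-1` [set beta] = [set w | forall i, side i (beta i) (eps i w)].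
  apply/seteqP; split => [w <- i|w Aw]; first by rewrite ffunE /side; case: asboolP.
  apply/ffunP => i; rewrite ffunE; have := Aw i; rewrite /side.
  by case: (beta i) => H; [apply/asboolP|apply/asboolPn].
have mF beta : measurable (F @^-1` [set beta]).
  rewrite FE (_ : [set w | _] = \bigcap_i (eps i @^-1` side i (beta i))).
    by apply: fin_bigcap_measurable => [|i _]; [exact: finite_finset|exact: measurable_eps_preimage].
  by apply/seteqP; split => [w Aw i _|w Aw i]; exact: Aw.
pose p i := prob P (eps i @^-1` A i).
have mEA i : measurable (eps i @^-1` A i) by exact: measurable_eps_preimage.
pose q i (c : bool) : R := if c then p i else 1 - p i.
have lawE beta : prob P (F @^-1` [set beta]) = \prod_i q i (beta i).
  apply: EFin_inj; rewrite -probE// FE (eps_box eps heps (fun i => side i (beta i)))// -prodEFin; apply: eq_bigr => i _.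
  rewrite -(eps_law eps heps i)// /side /q; case: (beta i); first exact: probE.
  rewrite -[_ @^-1` _]/(~` (eps i @^-1` A i)) probability_setC; last exact: mEA.
  by rewrite EFinB /p -probE.
have q0 i c : 0 <= q i c.
  by rewrite /q; case: c; rewrite ?subr_ge0 ?prob_ge0 ?prob_le1.
have -> : [set w | (#|[set i in S | `[< A i (eps i w) >]]%SET| < j)%N] =
    [set w | (#|[set i in S | F w i]%SET| < j)%N].
  apply: eq_set => w; rewrite (_ : [set i in S | _]%SET = [set i in S | F w i]%SET)//.
  by apply/setP => i; rewrite !inE ffunE.
rewrite (prob_finite_law P _ F mF (fun beta => (#|[set i in S | beta i]%SET| < j)%N)).
(* 2^-(number of successes), written as a product over all coordinates *)
pose h i (c : bool) : R := if (i \in S) && c then 2^-1 else 1.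
apply: (@le_trans _ _ (\sum_(beta : {ffun 'I_n -> bool}) 2 ^+ j * \prod_i (h i (beta i) * q i (beta i)))).
  rewrite big_mkcond; apply: ler_sum => beta _; rewrite lawE big_split/= mulrA.
  have hE : \prod_i h i (beta i) = (2^-1) ^+ #|[set i in S | beta i]%SET|.
    rewrite -prodr_const big_mkcond [RHS]big_mkcond; apply: eq_bigr => i _.
    by rewrite /h !inE.
  rewrite hE; case: ifP => [bj|_]; last first.
    by rewrite mulr_ge0 ?mulr_ge0 ?exprn_ge0// prodr_ge0.
  rewrite ler_peMl ?prodr_ge0// exprVn -expfB// exprn_ege1//.
  lra.
rewrite -mulr_sumr -(bigA_distr_bigA (fun i c => h i c * q i c)) ler_wpM2l ?exprn_ge0//.
rewrite [leRHS]big_mkcond; apply: ler_prod => i _; rewrite big_bool /h /q /=.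
have := prob_ge0 P (eps i @^-1` A i); have := prob_le1 P _ (mEA i); rewrite -/(p i).
by case: (i \in S) => /= p1 p0; apply/andP; split; lra.
Qed.

Lemma few_successes_exp S A (j : nat) (K : R) : (forall i, measurable (A i)) ->
  K * j%:R <= \sum_(i in S) prob P (eps i @^-1` A i) ->
  prob P [set w | (#|[set i in S | `[< A i (eps i w) >]]%SET| < j)%N] <=
  (2 * expR (- (K / 2))) ^+ j.
Proof.
move=> mA Kj; apply: le_trans (few_successes S A j mA) _.
rewrite exprMn ler_wpM2l ?exprn_ge0//.
apply: (@le_trans _ _ (\prod_(i in S) expR (- (prob P (eps i @^-1` A i) / 2)))).
  apply: ler_prod => i _; apply/andP; split; last exact: expR_ge1Dx.
  have := prob_le1 P _ (measurable_eps_preimage eps i _ (mA i)); lra.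
rewrite -expR_sum -expRM_natr ler_expR sumrN -mulr_suml; lra.
Qed.

Variable alpha : R.
Hypothesis ha : 0 < alpha < 1.
Variables (theta : n.-tuple R) (m : R).
Local Notation S := (nonnull theta).
Hypothesis hm : forall i, i \in S -> m <= `|tnth theta i|.
Local Notation obs := (@observation T R n (fun i => eps i) theta).
Local Notation crit := (gbs_critical n alpha).
Local Notation count x := (gbs_count alpha x).

Let small c i := [set z : R | 2 * std_normal_tail `|tnth theta i + z| <= c].

Let measurable_small c i : measurable (small c i).
Proof.
have mt : measurable_fun [set: R] (fun z : R => tnth theta i + z) by exact: measurable_funD.
by have := mt measurableT _ (measurable_two_sided_tail_le c); rewrite setTI.
Qed.

Let smallE c i : eps i @^-1` small c i = [set w | pvalue (obs w) i <= c].
Proof. by apply/seteqP; split => w; rewrite /small /= /pvalue tnth_observation. Qed.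

Let measurable_count_lt (J : nat) : measurable [set w | (count (obs w) < J)%N].
Proof.
apply: (measurable_obs_preimage eps theta [set x | (count x < J)%N]).
exact: (measurable_gbs_stat _ ha (fun k _ => (k < J)%N)).
Qed.

(** A signal of size at least m is pushed beyond t by every noise that exceeds
    t - m in the direction of the signal. *)
Lemma signal_pvalue_le i (t c : R) : i \in S -> 2 * std_normal_tail t <= c ->
  std_normal_tail (t - m) <= prob P [set w | pvalue (obs w) i <= c].
Proof.
move=> iS tc; rewrite -smallE -lee_fin -probE; last exact: measurable_eps_preimage.
rewrite (eps_law eps heps)//; have mi := hm i iS.
have big z : t <= `|tnth theta i + z| -> small c i z.
  by move=> /std_normal_tail_anti H; apply: le_trans tc; rewrite ler_pM2l.
have [ti|ti] := leP 0 (tnth theta i).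
  rewrite -std_normal_tailE; apply: le_measure; [by rewrite inE|by rewrite inE; exact: measurable_small|].
  move=> z; rewrite /= in_itv/= andbT => tz; apply: big.
  apply: le_trans (ler_norm _); rewrite ger0_norm// in mi; lra.
rewrite -std_normal_cdfN -std_normal_cdfE; apply: le_measure; [by rewrite inE|by rewrite inE; exact: measurable_small|].
move=> z; rewrite /= in_itv/= => tz; apply: big.
rewrite -normrN; apply: le_trans (ler_norm _); rewrite ltr0_norm// in mi; lra.
Qed.

(** If the procedure stops before rank J, then for some j <= J fewer than j
    signals have a p-value at most c_j, although at least K j are expected. *)
Lemma gbs_count_large (J : nat) (K : R) : (J <= n)%N ->
  (forall j, (0 < j <= J)%N -> exists2 t, 2 * std_normal_tail t <= crit j &
    K * j%:R <= #|S|%:R * std_normal_tail (t - m)) ->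
  prob P [set w | (count (obs w) < J)%N] <=
  \sum_(j < J) (2 * expR (- (K / 2))) ^+ j.+1.
Proof.
move=> Jn hK.
pose E (j : 'I_J) := [set w | (#|[set i in S | `[< small (crit j.+1) i (eps i w) >]]%SET| < j.+1)%N].
have mcount := measurable_count_lt J.
have Eh j w : #|[set i in S | `[< small (crit j) i (eps i w) >]]%SET| =
    #|[set i in S | pvalue (obs w) i <= crit j]%SET|.
  congr #|pred_of_set _|; apply/setP => i; rewrite !inE.
  by rewrite /small /pvalue tnth_observation asboolb.
have mE j : measurable (E j).
  rewrite (_ : E j = obs @^-1` [set x : n.-tuple R | (#|[set i in S | (pvalue x i <= crit j.+1)%R]%SET| < j.+1)%N]); last first.
    by apply: eq_set => w; rewrite Eh.
  apply: measurable_obs_preimage.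
  apply: (measurable_determined _ (fun i x => pvalue x i <= crit j.+1)) => [i|x y xy].
    exact: measurable_pvalue_le.
  rewrite (_ : [set i in S | pvalue x i <= _]%SET = [set i in S | pvalue y i <= crit j.+1]%SET)//.
  by apply/setP => i; rewrite !inE xy.
apply: (@le_trans _ _ (\sum_(j < J) prob P (E j))).
  apply: le_trans (prob_exists_le P _ predT _ mE).
  apply: prob_le => //.
    rewrite (_ : [set w | _] = \bigcup_j E j).
      by apply: fin_bigcup_measurable => //; exact: finite_finset.
    by apply/seteqP; split => w [j _ ?]; exists j.
  move=> w; apply: contraPP => nE; apply/negP; rewrite -leqNgt.
  apply: gbs_count_geq => // -[//|j] /= jJ.
  rewrite leqNgt; apply/negP => hj; apply: nE; exists (Ordinal jJ) => //=.
  rewrite /E /= Eh; apply: leq_ltn_trans hj; apply: subset_leq_card.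
  by apply/fintype.subsetP => i; rewrite !inE => /andP[].
apply: ler_sum => j _; apply: few_successes_exp => //.
have [t tc Kt] := hK j.+1 (ltn_ord j).
apply: (le_trans Kt); rewrite -sum1_card natr_sum mulr_suml.
by apply: ler_sum => i iS; rewrite mul1r smallE; exact: signal_pvalue_le.
Qed.

(** Once J hypotheses are rejected, the last critical value used is at least
    c_J, so a retained signal is at most t in absolute value. *)
Lemma gbs_miss_le (J : nat) (t : R) i : (0 < J <= n)%N -> i \in S ->
  2 * std_normal_tail t <= crit J ->
  1 - rejection_prob eps theta (gbs alpha) i <=
  std_normal_cdf (t - m) + prob P [set w | (count (obs w) < J)%N].
Proof.
move=> /andP[J0 Jn] iS tJ.
have mcount := measurable_count_lt J.
have mrej : measurable [set w | tnth (gbs alpha (obs w)) i].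
  apply: (measurable_obs_preimage eps theta [set x | tnth (gbs alpha x) i]).
  exact: (measurable_gbs_stat _ ha (fun _ v => tnth v i)).
have mp : measurable [set w | pvalue (obs w) i <= crit J].
  by rewrite -smallE; exact: measurable_eps_preimage.
rewrite -prob_setC//.
apply: (@le_trans _ _ (prob P (~` [set w | pvalue (obs w) i <= crit J] `|` [set w | (count (obs w) < J)%N]))).
  apply: prob_le; [exact: measurableC|by apply: measurableU => //; exact: measurableC|].
  move=> w /= nrej; have [|Jc] := ltnP (count (obs w)) J; [by right|left].
  move=> pJ; apply: nrej; rewrite gbs_rejects//.
  rewrite (leq_trans J0 Jc)/= (le_trans pJ)// gbs_critical_mono// Jc.
  exact: gbs_count_leq.
apply: le_trans (prob_setU_le _ _ _ _ _) _ => //; first exact: measurableC.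
rewrite lerD2r prob_setC//.
have := signal_pvalue_le i t _ iS tJ; have := cdf_add_tail (t - m); lra.
Qed.

End false_negatives.

(** * Hamming risk and the minimax lower bound *)

Section risk.
Context {d} {T : measurableType d} {R : realType} {P : probability T R} {n : nat}.
Variable eps : 'I_n -> {RV P >-> R}.
Hypothesis heps : iid_std_normal eps.
Local Notation obs := (@observation T R n (fun i => eps i)).
Variable phi : procedure R n.
Hypothesis mphi : measurable_fun [set: n.-tuple R] phi.
Implicit Types (i : 'I_n) (theta : n.-tuple R).

Definition error_prob theta i : R :=
  if i \in nonnull theta then 1 - rejection_prob eps theta phi i else rejection_prob eps theta phi i.

Lemma measurable_rejection_set i : measurable [set x : n.-tuple R | tnth (phi x) i].
Proof.
have mt := @measurable_tnth _ bool n i.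
have mi : measurable_fun setT (fun x : n.-tuple R => tnth (phi x) i).
  by have := measurableT_comp mt mphi.
by have := mi measurableT [set true] Logic.I; rewrite setTI.
Qed.

Lemma measurable_rejection theta i : measurable [set w | tnth (phi (obs theta w)) i].
Proof.
exact: (measurable_obs_preimage eps theta _ (measurable_rejection_set i)).
Qed.

Lemma error_prob_ge0 theta i : 0 <= error_prob theta i.
Proof.
rewrite /error_prob; case: ifP => _; last exact: prob_ge0.
by rewrite subr_ge0 prob_le1//; exact: measurable_rejection.
Qed.

Lemma hamming_riskE (s : nat) theta :
  hamming_risk P (fun i => eps i) s phi theta = (s%:R^-1 * \sum_i error_prob theta i)%:E.
Proof.
pose wrong i := if i \in nonnull theta then ~` [set w | tnth (phi (obs theta w)) i]
  else [set w | tnth (phi (obs theta w)) i].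
have mw i : measurable (wrong i).
  rewrite /wrong; case: ifP => _; last exact: measurable_rejection.
  by apply: measurableC; exact: measurable_rejection.
have wrongE i : P (wrong i) = (error_prob theta i)%:E.
  rewrite probE//; congr EFin; rewrite /wrong /error_prob; case: ifP => _ //.
  by rewrite prob_setC//; exact: measurable_rejection.
rewrite /hamming_risk EFinM; congr (_ * _)%E; rewrite unlock.
transitivity (\int[P]_w (\sum_i (\1_(wrong i) w)%:E))%E.
  apply: eq_integral => w _; rewrite sumEFin; congr EFin.
  rewrite natrD !natr_sum addrC [RHS](bigID (mem (nonnull theta)))/=; congr (_ + _);
    apply: eq_bigr => i; rewrite indicE /wrong.
    move=> iS; rewrite iS; case: (boolP (tnth _ i)) => rej.
      by rewrite memNset// => /(_ rej).
    by rewrite mem_set//=; exact/negP.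
  move=> /negbTE iS; rewrite iS; case: (boolP (tnth _ i)) => rej.
    by rewrite mem_set.
  by rewrite memNset//=; exact/negP.
rewrite ge0_integral_sum//; last by move=> i; exact/measurable_EFinP/measurable_indic.
rewrite -sumEFin; apply: eq_bigr => i _.
by rewrite integral_indic// setIT; exact: wrongE.
Qed.


(** One signal is hidden at one of the positions [p j].  On the event that
    another observation [p k] of the block is larger, the procedure either
    retains [p j], an error, or rejects it; by [swap_means] the latter is at
    least as likely with the signal at [p k], where it is a false rejection.
    Summing over j and k counts each such false rejection once. *)
Lemma block_error_ge (m : nat) (p : 'I_m -> 'I_n) theta (a : R) (beta : R) :
  injective p -> 0 < a -> (forall j, tnth theta (p j) = 0) ->
  (forall j, beta <= prob P (obs (set_coord (p j) a theta) @^-1`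
      [set x | exists2 k, k != j & tnth x (p j) <= tnth x (p k)])) ->
  m%:R * beta <= \sum_j \sum_k error_prob (set_coord (p j) a theta) (p k).
Proof.
move=> pinj a0 t0 hbeta; pose th j := set_coord (p j) a theta.
have in_th j k : (p k \in nonnull (th j)) = (k == j).
  rewrite inE tnth_set_coord (inj_eq pinj); case: (eqVneq k j) => _.
    by rewrite gt_eqF.
  by rewrite t0 eqxx.
pose rej j k := rejection_prob eps (th j) phi (p k).
have errE j : \sum_k error_prob (th j) (p k) = 1 - rej j j + \sum_(k | k != j) rej j k.
  rewrite (bigD1 j)//= /error_prob in_th eqxx; congr (_ + _).
  by apply: eq_bigr => k /negbTE kj; rewrite in_th kj.
under eq_bigr do rewrite errE.
pose L j k := [set x : n.-tuple R | tnth x (p j) <= tnth x (p k)].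
have mL j k : measurable (L j k).
  have mjk := measurable_fun_ler (@measurable_tnth _ R n (p j)) (@measurable_tnth _ R n (p k)).
  by have := mjk measurableT [set true] Logic.I; rewrite setTI.
pose Rj j := [set x : n.-tuple R | tnth (phi x) (p j)].
have mR j : measurable (Rj j) by exact: measurable_rejection_set.
have key j : beta <= 1 - rej j j + \sum_(k | k != j) rej k j.
  have mM : measurable [set x : n.-tuple R | exists2 k, k != j & L j k x].
    rewrite (_ : [set x | _] = \bigcup_(k in [set` [pred k | k != j]]) L j k).
      by apply: fin_bigcup_measurable => //; exact: finite_finset.
    by apply/seteqP; split => x [k kj Lk]; exists k.
  apply: (le_trans (hbeta j)).
  apply: (@le_trans _ _ (prob P (obs (th j) @^-1` (~` Rj j) `|`
      [set w | exists2 k, k != j & (obs (th j) @^-1` (L j k `&` Rj j)) w]))).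
    apply: prob_le.
    - exact: measurable_obs_preimage.
    - apply: measurableU; first by apply: measurable_obs_preimage; exact: measurableC.
      rewrite (_ : [set w | _] = \bigcup_(k in [set` [pred k | k != j]]) (obs (th j) @^-1` (L j k `&` Rj j))).
        apply: fin_bigcup_measurable => [|k _]; first exact: finite_finset.
        by apply: measurable_obs_preimage; exact: measurableI.
      by apply/seteqP; split => x [k kj Lk]; exists k.
    move=> w [k kj Lk]; have [r|r] := boolP (tnth (phi (obs (th j) w)) (p j)); [right|left].
      by exists k.
    exact/negP.
  apply: le_trans (prob_setU_le _ _ _ _ _) _.
  - by apply: measurable_obs_preimage; exact: measurableC.
  - rewrite (_ : [set w | _] = \bigcup_(k in [set` [pred k | k != j]]) (obs (th j) @^-1` (L j k `&` Rj j))).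
      apply: fin_bigcup_measurable => [|k _]; first exact: finite_finset.
      by apply: measurable_obs_preimage; exact: measurableI.
    by apply/seteqP; split => x [k kj Lk]; exists k.
  apply: lerD.
    rewrite preimage_setC prob_setC//; exact: measurable_rejection.
  apply: le_trans (prob_exists_le _ _ _ _ _) _.
    by move=> k; apply: measurable_obs_preimage; exact: measurableI.
  apply: ler_sum => k kj.
  apply: (@le_trans _ _ (prob P (obs (th k) @^-1` (L j k `&` Rj j)))); last first.
    apply: prob_le; [|exact: measurable_rejection|by move=> w []].
    by apply: measurable_obs_preimage; exact: measurableI.
  rewrite -lee_fin -!probE; [|by apply: measurable_obs_preimage; exact: measurableI..].
  by apply: swap_means => //; [exact: measurableI|exact: ltW|move=> x []].
apply: (@le_trans _ _ (\sum_(j < m) beta)); first by rewrite sumr_const card_ord mulr_natl.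
apply: (@le_trans _ _ (\sum_j (1 - rej j j + \sum_(k | k != j) rej k j))); first exact: ler_sum.
rewrite !big_split/= lerD2l (exchange_big_dep predT)//=.
by apply: ler_sum => j _; rewrite (eq_bigl (fun k => k != j))// => k; rewrite eq_sym.
Qed.

End risk.

(** Exchanging the new value at [q] with the one that it replaces is an
    involution of the pairs (J, j).  This isolates the uniform choice of the
    position in one block from the choices in the others. *)
Lemma sum_ffun_update {R : realType} (I D : finType) (q : I) (g : {ffun I -> D} -> R) :
  #|D|%:R * \sum_J g J = \sum_(J : {ffun I -> D}) \sum_j g [ffun k => if k == q then j else J k].
Proof.
pose upd (J : {ffun I -> D}) j := [ffun k => if k == q then j else J k].
pose swap (u : {ffun I -> D} * D) := (upd u.1 u.2, u.1 q).
have swapK : involutive swap.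
  move=> [J j]; rewrite /swap /=; congr pair; last by rewrite ffunE eqxx.
  by apply/ffunP => k; rewrite !ffunE; case: eqP => // ->.
rewrite pair_bigA/=.
have -> : \sum_(p : {ffun I -> D} * D) g (upd p.1 p.2) = \sum_(p : {ffun I -> D} * D) g p.1.
  rewrite [RHS](reindex_inj (inv_inj swapK)) /=; apply: eq_bigr => -[J j] _ //.
rewrite -(pair_bigA _ (fun J _ => g J))/= mulr_sumr; apply: eq_bigr => J _.
by rewrite sumr_const mulr_natl.
Qed.

Section lower_bound.
Context {d} {T : measurableType d} {R : realType} {P : probability T R} {n : nat}.
Variable eps : 'I_n -> {RV P >-> R}.
Hypothesis heps : iid_std_normal eps.
Local Notation obs := (@observation T R n (fun i => eps i)).

(** If the noise at the signal is at most v - a, the observation there is at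
    most v; it is overtaken unless all the other noises of the block are at
    most v, which has probability cdf (v)^(m - 1). *)
Lemma overtaken_prob_ge (m : nat) (p : 'I_m -> 'I_n) theta (a v : R) (j : 'I_m) :
  injective p -> (forall k, tnth theta (p k) = 0) ->
  std_normal_cdf (v - a) - std_normal_cdf v ^+ m.-1 <=
  prob P (obs (set_coord (p j) a theta) @^-1`
      [set x | exists2 k, k != j & tnth x (p j) <= tnth x (p k)]).
Proof.
move=> pinj t0.
pose A := eps (p j) @^-1` `]-oo, v - a].
pose J := [set p k | k in [set~ j]%SET]%SET.
pose B := [set w | forall i, i \in J -> `]-oo, v]%classic (eps i w)].
have mA : measurable A by exact: measurable_eps_preimage.
have mB : measurable B.
  rewrite (_ : B = \bigcap_(i in [set` J]) (eps i @^-1` `]-oo, v])).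
    apply: fin_bigcap_measurable => [|i _]; first exact: finite_finset.
    exact: measurable_eps_preimage.
  by apply/seteqP; split.
have pA : prob P A = std_normal_cdf (v - a).
  by rewrite /prob (eps_law eps heps).
have pB : prob P B = std_normal_cdf v ^+ m.-1.
  rewrite /prob (eps_box_in eps heps J (fun=> `]-oo, v]%classic))//.
  under eq_bigr do rewrite std_normal_cdfE.
  rewrite prodEFin /= prodr_const; congr (_ ^+ _).
  by rewrite /J card_imset// cardsC1 card_ord.
rewrite -pA -pB.
have := prob_setI_setC P A B mA mB; have := prob_le P (A `&` B) B (measurableI _ _ mA mB) mB.
move=> /(_ (@subIsetr _ _ _)).
have : prob P (A `&` ~` B) <= prob P (obs (set_coord (p j) a theta) @^-1`
      [set x | exists2 k, k != j & tnth x (p j) <= tnth x (p k)]).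
  apply: prob_le.
  - by apply: measurableI => //; exact: measurableC.
  - apply: measurable_obs_preimage.
    rewrite (_ : [set x | _] = \bigcup_(k in [set` [pred k | k != j]])
        [set x : n.-tuple R | tnth x (p j) <= tnth x (p k)]).
      apply: fin_bigcup_measurable => [|k _]; first exact: finite_finset.
      have mjk := measurable_fun_ler (@measurable_tnth _ R n (p j)) (@measurable_tnth _ R n (p k)).
      by have := mjk measurableT [set true] Logic.I; rewrite setTI.
    by apply/seteqP; split => x [k kj Lk]; exists k.
  move=> w [Aw nBw]; apply: contrapT => H; apply: nBw => i /imsetP[k]; rewrite !inE => kj ->.
  rewrite /= in_itv/= leNgt; apply/negP => vk; apply: H; exists k => //.
  rewrite !tnth_observation !tnth_set_coord eqxx (inj_eq pinj) (negbTE kj) t0 add0r.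
  by move: Aw; rewrite /A /= in_itv/=; lra.
lra.
Qed.

Section blocks.
Variables (s m : nat).
Hypothesis smn : (s * m <= n)%N.

Let pos_lt (q : 'I_s) (r : 'I_m) : (q * m + r < n)%N.
Proof.
apply: leq_trans smn; apply: (@leq_trans (q.+1 * m)); last by rewrite leq_mul2r ltn_ord orbT.
by rewrite mulSnr -addnS leq_add2l.
Qed.

Definition block_pos (q : 'I_s) (r : 'I_m) : 'I_n := Ordinal (pos_lt q r).

Lemma block_pos_inj q r q' r' : block_pos q r = block_pos q' r' -> q = q' /\ r = r'.
Proof.
move=> /(congr1 val)/= H; have m0 : (0 < m)%N := leq_ltn_trans (leq0n _) (ltn_ord r).
split; apply/val_inj => /=.
  by have := congr1 (fun k => k %/ m)%N H; rewrite !divnMDl// !divn_small// !addn0.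
by have := congr1 (fun k => k %% m)%N H; rewrite !modnMDl !modn_small.
Qed.

(** The least favourable signals: one of size [a] in each block, at the position
    that [J] chooses. *)
Definition block_signal (a : R) (J : {ffun 'I_s -> 'I_m}) : n.-tuple R :=
  [tuple if [exists q, i == block_pos q (J q)] then a else 0 | i < n].

Lemma block_signal_class a b J : 0 < a -> a = Num.sqrt (2 * ln (n%:R / s%:R)) + b ->
  beta_min_class s b (block_signal a J).
Proof.
move=> a0 aE.
have nonE : nonnull (block_signal a J) = [set block_pos q (J q) | q : 'I_s]%SET.
  apply/setP => i; rewrite inE tnth_mktuple; apply/idP/imsetP.
    case: existsP => [[q /eqP ->] _|]; first by exists q.
    by rewrite eqxx.
  move=> [q _ ->]; case: existsP => [_|[]]; first by rewrite gt_eqF.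
  by exists q.
split.
  by rewrite nonE card_imset ?card_ord// => q q' /block_pos_inj[-> _].
move=> i; rewrite inE tnth_mktuple; case: ifP => [_ _|_]; last by rewrite eqxx.
by rewrite -aE ger0_norm ?(ltW a0).
Qed.

(** The errors within the blocks are averaged over all [J].  For the block q,
    the average over the other choices is taken last, so that [block_error_ge]
    applies with all signals but that of the block q fixed. *)
Lemma block_signal_risk (phi : procedure R n) (a v : R) :
  measurable_fun [set: n.-tuple R] phi -> 0 < a -> (0 < s)%N -> (0 < m)%N ->
  exists J, ((std_normal_cdf (v - a) - std_normal_cdf v ^+ m.-1)%:E <=
     hamming_risk P (fun i => eps i) s phi (block_signal a J))%E.
Proof.
move=> mphi a0 s0 m0; set beta := _ - _.
pose err := error_prob eps phi.
pose g q J := \sum_r err (block_signal a J) (block_pos q r).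
have gle J : \sum_q g q J <= \sum_i err (block_signal a J) i.
  rewrite pair_bigA/=.
  pose f (u : 'I_s * 'I_m) := block_pos u.1 u.2.
  have finj : injective f by move=> [q r] [q' r'] /block_pos_inj[/= -> ->].
  rewrite -(big_imset (fun i => err (block_signal a J) i) (in2W finj)).
  rewrite [leRHS](bigID (mem (f @: predT)))/= lerDl sumr_ge0// => i _.
  exact: error_prob_ge0.
have gsum q : #|{ffun 'I_s -> 'I_m}|%:R * beta <= \sum_J g q J.
  rewrite -(@ler_pM2l _ m%:R) ?ltr0n// -[X in _ <= X%:R * _]card_ord (sum_ffun_update _ _ q).
  have -> : m%:R * (#|{ffun 'I_s -> 'I_m}|%:R * beta) = \sum_(J : {ffun 'I_s -> 'I_m}) m%:R * beta.
    by rewrite sumr_const mulrCA !mulr_natl.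
  apply: ler_sum => J _.
  pose base := [tuple if [exists q', (q' != q) && (i == block_pos q' (J q'))] then a else 0 | i < n].
  have base0 r : tnth base (block_pos q r) = 0.
    rewrite tnth_mktuple; case: existsP => // -[q' /andP[q'q /eqP/block_pos_inj[qq' _]]].
    by rewrite qq' eqxx in q'q.
  have pinj : injective (block_pos q) by move=> r r' /block_pos_inj[].
  have updE j : block_signal a [ffun k => if k == q then j else J k] = set_coord (block_pos q j) a base.
    apply: eq_from_tnth => i; rewrite tnth_set_coord !tnth_mktuple.
    have [->|ij] := eqVneq i (block_pos q j).
      by case: existsP => // -[]; exists q; rewrite ffunE eqxx.
    congr (if _ then _ else _); apply: eq_existsb => q'; rewrite ffunE.
    have [->|] := eqVneq q' q; last by [].
    by rewrite (negbTE ij).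
  rewrite /g /err; under eq_bigr do rewrite updE.
  apply: (block_error_ge eps heps phi mphi) => // j.
  exact: overtaken_prob_ge.
have [J hJ] : exists J, s%:R * beta <= \sum_i err (block_signal a J) i.
  apply: contrapT => /forallNP H.
  have : \sum_(J : {ffun 'I_s -> 'I_m}) \sum_i err (block_signal a J) i <
      \sum_(J : {ffun 'I_s -> 'I_m}) s%:R * beta.
    apply: ltr_sum => [|J _]; last by rewrite ltNge; apply/negP.
    apply/hasP; exists [ffun=> Ordinal m0] => //; exact: mem_index_enum.
  apply/negP; rewrite -leNgt.
  apply: (@le_trans _ _ (\sum_J \sum_q g q J)); last exact: ler_sum.
  apply: (@le_trans _ _ (\sum_(q < s) #|{ffun 'I_s -> 'I_m}|%:R * beta)).
    by rewrite !sumr_const card_ord !mulr_natl mulrnAC.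
  by rewrite exchange_big; apply: ler_sum.
exists J; rewrite (hamming_riskE eps phi mphi) lee_fin ler_pdivlMl ?ltr0n//.
Qed.

End blocks.

Lemma minimax_risk_ge (s m : nat) (b v : R) : (s * m <= n)%N -> (0 < s)%N -> (0 < m)%N ->
  let a := Num.sqrt (2 * ln (n%:R / s%:R)) + b in 0 < a ->
  ((std_normal_cdf (v - a) - std_normal_cdf v ^+ m.-1)%:E <=
     minimax_risk P (fun i => eps i) s b)%E.
Proof.
move=> smn s0 m0 a a0; apply: le_ereal_inf_tmp => _ [phi mphi <-].
have [J hJ] := block_signal_risk s m smn phi a v mphi a0 s0 m0.
apply: (le_trans hJ); apply: ereal_sup_ubound; exists (block_signal s m smn a J) => //.
exact: block_signal_class.
Qed.

End lower_bound.

(** * Risk bounds for a fixed sample size *)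

Section finite_sample.
Context {d} {T : measurableType d} {R : realType} {P : probability T R} {n : nat}.
Variable eps : 'I_n -> {RV P >-> R}.
Hypothesis heps : iid_std_normal eps.
Local Notation c := (normal_peak (1 : R)).

Lemma peak_gt0 : 0 < c. Proof. exact: normal_peak_gt0. Qed.

Lemma expR_le_inv (x : R) : 0 < x -> expR (- x) <= x^-1.
Proof.
move=> x0; rewrite expRN lef_pV2 ?posrE ?expR_gt0//.
by apply: le_trans (expR_ge1Dx x); rewrite lerDr.
Qed.

Lemma geometric_tail_le (q : R) (J : nat) : 0 <= q <= 2^-1 ->
  \sum_(j < J) q ^+ j.+1 <= 2 * q.
Proof.
move=> /andP[q0 q2].
suff : \sum_(j < J) q ^+ j.+1 <= 2 * q - 2 * q ^+ J.+1.
  by move=> /le_trans; apply; rewrite gerBl mulr_ge0// exprn_ge0.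
elim: J => [|J IH]; first by rewrite big_ord0 expr1 subrr.
rewrite big_ord_recr/=; apply: (le_trans (lerD IH (lexx _))).
have : 0 <= q ^+ J.+1 by rewrite exprn_ge0.
rewrite (exprS q J.+1) => y0.
have : q * q ^+ J.+1 <= 2^-1 * q ^+ J.+1 by rewrite ler_wpM2r.
lra.
Qed.

(** A rank J that is reached with high probability bounds the risk by the
    probability that a signal is missed at the threshold t of c_J. *)
Lemma gbs_risk_le (alpha m t K : R) (theta : n.-tuple R) (s J : nat) :
  0 < alpha < 1 -> alpha <= 2^-1 -> (0 < s)%N -> #|nonnull theta| = s ->
  (forall i, i \in nonnull theta -> m <= `|tnth theta i|) ->
  (0 < J <= n)%N -> 2 * std_normal_tail t <= gbs_critical n alpha J ->
  (forall j, (0 < j <= J)%N -> exists2 u, 2 * std_normal_tail u <= gbs_critical n alpha j &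
    K * j%:R <= s%:R * std_normal_tail (u - m)) ->
  2 * expR (- (K / 2)) <= 2^-1 ->
  (hamming_risk P (fun i => eps i) s (gbs alpha) theta <=
   (std_normal_cdf (t - m) + 4 * alpha + 4 * expR (- (K / 2)))%:E)%E.
Proof.
move=> ha a2 s0 Ss hm /andP[J0 Jn] tJ hK Kq.
rewrite (hamming_riskE eps _ (measurable_gbs _ ha)) lee_fin ler_pdivrMl ?ltr0n//.
have sR : 1 <= s%:R :> R by rewrite ler1n.
have a0 : 0 < alpha by case/andP: ha.
rewrite (bigID (mem (nonnull theta)))/=.
have fp : \sum_(i | i \notin nonnull theta) error_prob eps (gbs alpha) theta i <= s%:R * (4 * alpha).
  rewrite (eq_bigr (rejection_prob eps theta (gbs alpha))); last first.
    by move=> i iN; rewrite /error_prob (negbTE iN).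
  have := gbs_false_positives eps heps _ ha theta; rewrite Ss.
  have : 0 <= \sum_(i | i \notin nonnull theta) rejection_prob eps theta (gbs alpha) i.
    by apply: sumr_ge0 => i _; exact: prob_ge0.
  move: (\sum_(i | i \notin nonnull theta) _) => V V0 hV.
  have : alpha * V <= 2^-1 * V by rewrite ler_wpM2r.
  have : alpha * 1 <= alpha * s%:R by rewrite ler_wpM2l// ltW.
  move: hV; rewrite !mulrDr; lra.
have fn : \sum_(i in nonnull theta) error_prob eps (gbs alpha) theta i <=
    s%:R * (std_normal_cdf (t - m) + 4 * expR (- (K / 2))).
  rewrite -Ss -sum1_card natr_sum mulr_suml; apply: ler_sum => i iS.
  rewrite mul1r /error_prob iS.
  apply: (le_trans (gbs_miss_le eps heps _ ha theta m hm J t i _ iS tJ)); first by rewrite J0.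
  rewrite lerD2l; apply: (le_trans (gbs_count_large eps heps _ ha theta m hm J K Jn _)).
    by rewrite Ss.
  apply: (le_trans (geometric_tail_le _ _ _)); first by rewrite Kq mulr_ge0 ?expR_ge0.
  lra.
apply: (le_trans (lerD fn fp)); rewrite -mulrDr ler_wpM2l//; lra.
Qed.

(** J is the least integer for which J alpha / (n + 1), a lower bound of c_J,
    exceeds 2 exp (- (a + delta)^2 / 2), an upper bound of the p-value at
    a + delta.  For the ranks j below, u is chosen in the same way, by
    j = 2 (n + 1) exp (- u^2 / 2) / alpha; with h = u - a >= delta and
    B = |b| + 1, the inequality K j <= s T(u - a - b) reduces to
    4 K / (c alpha) <= exp (h (a - B) - B^2 / 2), c being the value at 0 of the
    normal density.  For J itself, both
    J / s <= 4 exp (- delta a / 2) + 1 / s and T(delta - b) are compared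
    directly. *)
Lemma gbs_detection_levels (alpha a b delta K : R) (s : nat) :
  0 < alpha < 1 -> (0 < s <= n)%N -> n%:R = s%:R * expR (a ^+ 2 / 2) ->
  0 < delta -> 1 <= K -> `|b| + 1 <= a ->
  alpha^-1 <= expR (delta * a / 2) ->
  4 * K / c <= delta * a / 2 - delta * (`|b| + 1) - (`|b| + 1) ^+ 2 / 2 ->
  K * (4 * expR (- (delta * a / 2)) + s%:R^-1) <= std_normal_tail (delta - b) ->
  exists J, [/\ (0 < J <= n)%N, 2 * std_normal_tail (a + delta) <= gbs_critical n alpha J &
    forall j, (0 < j <= J)%N -> exists2 u, 2 * std_normal_tail u <= gbs_critical n alpha j &
      K * j%:R <= s%:R * std_normal_tail (u - (a + b))].
Proof.
move=> ha /andP[s0 sn] nE d0 K1 aB aalpha c1 c2.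
have a0 : 0 < alpha by case/andP: ha.
have K0 : 0 < K by lra.
have apos : 0 < a by have := normr_ge0 b; lra.
have sR : 0 < s%:R :> R by rewrite ltr0n.
have nR : 1 <= n%:R :> R by rewrite ler1n (leq_trans s0).
have N0 : 0 < n%:R + 1 :> R by lra.
set x := 2 * (n%:R + 1) * expR (- (a + delta) ^+ 2 / 2) / alpha.
have x0 : 0 < x by rewrite divr_gt0// !mulr_gt0// expR_gt0.
set J := (Num.truncn x).+1.
have xJ : x < J%:R by exact: truncnS_gt.
have Jx : J%:R <= x + 1 by rewrite -natr1 lerD2r truncn_le// ltW.
have xs : x <= s%:R * (4 * expR (- (delta * a / 2))).
  apply: (@le_trans _ _ (4 * n%:R * expR (- (a + delta) ^+ 2 / 2) * expR (delta * a / 2))).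
    rewrite /x; apply: ler_pM; last exact: aalpha.
    - by rewrite mulr_ge0 ?expR_ge0// mulr_ge0// ltW.
    - by rewrite invr_ge0 ltW.
    - by rewrite ler_wpM2r ?expR_ge0//; lra.
  rewrite nE -!mulrA -!expRD mulrCA ler_pM2l// ler_pM2l// ler_expR.
  have : 0 <= delta * delta by rewrite mulr_ge0// ltW.
  by rewrite !expr2; lra.
have KJs : K * J%:R <= s%:R * std_normal_tail (delta - b).
  apply: (@le_trans _ _ (s%:R * (K * (4 * expR (- (delta * a / 2)) + s%:R^-1)))); last first.
    by rewrite ler_pM2l.
  rewrite mulrCA ler_pM2l//; apply: (le_trans Jx).
  by rewrite mulrDr mulfV ?lerD2r// gt_eqF.
have Jn : (J <= n)%N.
  apply: leq_trans sn; rewrite -(@ler_nat R).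
  apply: (@le_trans _ _ (K * J%:R)); first by rewrite ler_peMl//.
  by apply: (le_trans KJs); apply: ler_piMr; [exact: ltW|exact: std_normal_tail_le1].
have tJ : 2 * std_normal_tail (a + delta) <= gbs_critical n alpha J.
  apply: (le_trans _ (gbs_critical_ge _ ha _ Jn)).
  apply: (@le_trans _ _ (x * alpha / (n%:R + 1))); last first.
    by rewrite !ler_wpM2r ?invr_ge0 ?(ltW xJ)// ltW.
  rewrite /x divfK ?gt_eqF// (_ : _ / _ = 2 * expR (- (a + delta) ^+ 2 / 2)).
    by rewrite ler_pM2l// std_normal_tail_le// addr_ge0// ltW.
  by field; rewrite gt_eqF.
exists J; split => // j /andP[j0 jJ].
have jR : 0 < j%:R :> R by rewrite ltr0n.
have [xj|jx] := ltP x j%:R.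
  have jE : j = J.
    by apply/eqP; rewrite eqn_leq jJ /J /= truncn_lt_nat// ltW.
  exists (a + delta); first by rewrite jE.
  by rewrite jE (_ : a + delta - (a + b) = delta - b)//; ring.
set y := 2 * (n%:R + 1) / (j%:R * alpha).
have ja : 0 < j%:R * alpha by rewrite mulr_gt0.
have yge : expR ((a + delta) ^+ 2 / 2) <= y.
  rewrite ler_pdivlMr// mulrA -ler_pdivlMr// -ler_pdivlMl ?expR_gt0//.
  by apply: (le_trans jx); rewrite /x mulNr expRN; lra.
have y0 : 0 < y by rewrite divr_gt0 ?mulr_gt0.
have lny : (a + delta) ^+ 2 / 2 <= ln y by rewrite -ler_expR lnK.
pose u := Num.sqrt (2 * ln y).
have u2 : u ^+ 2 = 2 * ln y.
  by rewrite sqr_sqrtr// mulr_ge0// (le_trans _ lny)// divr_ge0// sqr_ge0.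
have au : a + delta <= u.
  have ad0 : 0 <= a + delta by lra.
  rewrite -(@ler_pXn2r _ 2)// ?nnegrE ?sqrtr_ge0// u2.
  lra.
have jE : j%:R = 2 * (n%:R + 1) / alpha * expR (- u ^+ 2 / 2).
  have -> : - u ^+ 2 / 2 = - ln y by rewrite u2; field.
  rewrite expRN lnK ?posrE// /y.
  by field; rewrite !gt_eqF.
exists u.
  apply: (le_trans _ (gbs_critical_ge _ ha _ (leq_trans jJ Jn))).
  have -> : j%:R * alpha / (n%:R + 1) = 2 * expR (- u ^+ 2 / 2).
    by rewrite jE; field; rewrite !gt_eqF.
  by rewrite ler_pM2l// std_normal_tail_le// sqrtr_ge0.
set h := u - a; have hd : delta <= h by rewrite /h; lra.
have hb0 : 0 <= h + `|b| by have := normr_ge0 b; lra.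
have tl : normal_pdf 0 1 (h + `|b| + 1) <= std_normal_tail (u - (a + b)).
  have := std_normal_tail_ge 1 (h + `|b|) hb0 ler01; rewrite mul1r => /le_trans; apply.
  by apply: std_normal_tail_anti; rewrite /h; have := ler_norm (- b); rewrite normrN; lra.
apply: (@le_trans _ _ (s%:R * normal_pdf 0 1 (h + `|b| + 1))); last by rewrite ler_pM2l.
rewrite jE normal_pdf1E subr0.
apply: (@le_trans _ _ (K * (4 * n%:R * expR (delta * a / 2) * expR (- u ^+ 2 / 2)))).
  rewrite ler_pM2l// ler_wpM2r ?expR_ge0//; apply: ler_pM; last exact: aalpha.
  - by rewrite mulr_ge0// ltW.
  - by rewrite invr_ge0 ltW.
  - lra.
rewrite nE; set B := `|b| + 1.
have -> : h + `|b| + 1 = h + B by rewrite addrA.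
have c0 := peak_gt0.
have key : 4 * K * (expR (a ^+ 2 / 2) * expR (delta * a / 2) * expR (- u ^+ 2 / 2)) <=
    c * expR (- (h + B) ^+ 2 / 2).
  pose E1 := - (h + B) ^+ 2 / 2 - (a ^+ 2 / 2 + delta * a / 2 + - u ^+ 2 / 2).
  have -> : - (h + B) ^+ 2 / 2 = E1 + (a ^+ 2 / 2 + delta * a / 2 + - u ^+ 2 / 2) by rewrite subrK.
  rewrite -!expRD [expR (E1 + _)]expRD mulrA ler_wpM2r ?expR_ge0// [c * _]mulrC -ler_pdivrMr//.
  apply: (le_trans c1); apply: le_trans (expR_ge1Dx _).
  have aB0 : 0 <= (h - delta) * (a - B) by rewrite mulr_ge0// subr_ge0.
  have uE : u = a + h by rewrite /h addrC subrK.
  rewrite /E1 uE -/B; lra.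
have := ler_wpM2l (ltW sR) key; apply: le_trans; rewrite le_eqVlt; apply/orP; left; apply/eqP; ring.
Qed.

Lemma gbs_risk_finite (alpha a b delta K : R) (s : nat) (theta : n.-tuple R) :
  0 < alpha < 1 -> alpha <= 2^-1 -> (0 < s <= n)%N -> n%:R = s%:R * expR (a ^+ 2 / 2) ->
  0 < delta -> 1 <= K -> 2 * expR (- (K / 2)) <= 2^-1 -> `|b| + 1 <= a ->
  alpha^-1 <= expR (delta * a / 2) ->
  4 * K / c <= delta * a / 2 - delta * (`|b| + 1) - (`|b| + 1) ^+ 2 / 2 ->
  K * (4 * expR (- (delta * a / 2)) + s%:R^-1) <= std_normal_tail (delta - b) ->
  #|nonnull theta| = s ->
  (forall i, i \in nonnull theta -> a + b <= `|tnth theta i|) ->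
  (hamming_risk P (fun i => eps i) s (gbs alpha) theta <=
   (std_normal_tail (b - delta) + 4 * alpha + 4 * expR (- (K / 2)))%:E)%E.
Proof.
move=> ha a2 ss nE d0 K1 Kq aB aalpha c1 c2 Ss hm.
have [J [Jn tJ hJ]] := gbs_detection_levels alpha a b delta K s ha ss nE d0 K1 aB aalpha c1 c2.
case/andP: ss => s0 _.
have := gbs_risk_le alpha (a + b) (a + delta) K theta s J ha a2 s0 Ss hm Jn tJ hJ Kq.
by rewrite (_ : a + delta - (a + b) = - (b - delta)) ?std_normal_cdfN//; ring.
Qed.

(** The level v = a - delta of [overtaken_prob_ge] is exceeded by a given noise
    with probability at least of order exp (a delta / 2) s / n, hence by some
    noise of a block of n / s coordinates except with probability that tends
    to 0 as a grows. *)
Lemma minimax_risk_ge_finite (a b delta : R) (s : nat) : (0 < s)%N -> 4 * s%:R <= n%:R :> R ->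
  a = Num.sqrt (2 * ln (n%:R / s%:R)) -> n%:R = s%:R * expR (a ^+ 2 / 2) ->
  0 < delta -> delta <= a -> 0 < a + b ->
  0 < delta * a / 2 - delta ^+ 2 / 8 ->
  ((std_normal_tail (b + delta) - (delta * c / 4 * (delta * a / 2 - delta ^+ 2 / 8))^-1)%:E <=
    minimax_risk P (fun i => eps i) s b)%E.
Proof.
move=> s0 sn aE nE d0 da ab y0.
have sR : 0 < s%:R :> R by rewrite ltr0n.
have c0 := peak_gt0.
set m := (n %/ s)%N.
have mL : n%:R / s%:R < m%:R + 1 :> R.
  by rewrite ltr_pdivrMr// natr1 -natrM ltr_nat ltn_ceil.
have L4 : 4 <= n%:R / s%:R :> R by rewrite ler_pdivlMr.
have m0 : (0 < m)%N by rewrite -(@ltr_nat R); lra.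
have smn : (s * m <= n)%N by rewrite mulnC leq_trunc_div.
have := minimax_risk_ge eps heps s m b (a - delta) smn s0 m0; rewrite -aE => /(_ ab).
apply: le_trans; rewrite lee_fin.
have -> : std_normal_cdf (a - delta - (a + b)) = std_normal_tail (b + delta).
  by rewrite -std_normal_cdfN; congr std_normal_cdf; ring.
rewrite lerD2l lerN2.
set t := std_normal_tail (a - delta).
have t1 : 1 - t = std_normal_cdf (a - delta).
  by have := cdf_add_tail (a - delta); rewrite -/t; lra.
have mt : delta * c / 4 * (delta * a / 2 - delta ^+ 2 / 8) <= m.-1%:R * t.
  have tge : delta / 2 * normal_pdf 0 1 (a - delta + delta / 2) <= t.
    by apply: std_normal_tail_ge; [rewrite subr_ge0|rewrite divr_ge0// ltW].
  have m1 : n%:R / s%:R / 2 <= m.-1%:R :> R.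
    by rewrite -subn1 natrB//; lra.
  apply: (@le_trans _ _ (n%:R / s%:R / 2 * (delta / 2 * normal_pdf 0 1 (a - delta + delta / 2)))); last first.
    apply: ler_pM; [lra| |exact: m1|exact: tge].
    by rewrite mulr_ge0 ?normal_pdf_ge0// divr_ge0// ltW.
  rewrite normal_pdf1E subr0 nE [s%:R * _ / _]mulrAC mulfV ?gt_eqF// mul1r.
  have -> : expR (a ^+ 2 / 2) / 2 * (delta / 2 * (c * expR (- (a - delta + delta / 2) ^+ 2 / 2))) =
      delta * c / 4 * expR (a ^+ 2 / 2 + - (a - delta + delta / 2) ^+ 2 / 2).
    by rewrite expRD; field.
  have dc : 0 < delta * c / 4 by rewrite divr_gt0// mulr_gt0.
  rewrite (ler_pM2l dc).
  apply: le_trans (expR_ge1Dx _).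
  have -> : a ^+ 2 / 2 + - (a - delta + delta / 2) ^+ 2 / 2 = delta * a / 2 - delta ^+ 2 / 8 by field.
  by rewrite lerDr.
have y1 : 0 < delta * c / 4 * (delta * a / 2 - delta ^+ 2 / 8).
  by rewrite mulr_gt0// divr_gt0 ?(mulr_gt0 d0 c0).
rewrite -t1.
apply: (@le_trans _ _ (expR (- t) ^+ m.-1)).
  rewrite lerXn2r ?nnegrE ?expR_ge0 ?subr_ge0 ?std_normal_tail_le1//.
  exact: expR_ge1Dx.
rewrite -expRM_natr mulNr mulrC; apply: le_trans (expR_le_inv _ y1).
by rewrite ler_expR lerN2.
Qed.

End finite_sample.

(** * Asymptotics *)

Section asymptotics.
Context {R : realType}.
Local Notation c := (normal_peak (1 : R)).

Variables (d : nat -> measure_display) (Omega : forall n : nat, measurableType (d n))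
  (P : forall n : nat, probability (Omega n) R)
  (eps : forall n : nat, 'I_n -> {RV (P n) >-> R})
  (s : nat -> nat) (alpha : nat -> R) (b : R).
Hypotheses (heps : forall n : nat, iid_std_normal (eps n))
  (hs : forall n : nat, (0 < n)%N -> (0 < s n <= n)%N)
  (halpha : forall n : nat, (0 < n)%N -> 0 < alpha n < 1)
  (hs_infty : s n @[n --> \oo] --> \oo)
  (hns_infty : (n%:R / (s n)%:R : R) @[n --> \oo] --> +oo)
  (halpha0 : alpha n @[n --> \oo] --> (0 : R))
  (hlogalpha : (fun n : nat => ln (1 / alpha n)) =o_\oo
               (fun n : nat => Num.sqrt (ln (n%:R / (s n)%:R)))).

Let risk_gbs n := sup_risk (P n) (fun i => eps n i) (s n) b (gbs (alpha n)).
Let risk_minimax n := minimax_risk (P n) (fun i => eps n i) (s n) b.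

(** The solution a of s exp (a^2 / 2) = n. *)
Let level n : R := Num.sqrt (2 * ln (n%:R / (s n)%:R)).

Let ratio_ge1 n : (0 < n)%N -> 1 <= n%:R / (s n)%:R :> R.
Proof.
move=> /hs /andP[s0 sn]; rewrite ler_pdivlMr ?ltr0n// mul1r ler_nat//.
Qed.

Let levelE n : (0 < n)%N -> n%:R = (s n)%:R * expR (level n ^+ 2 / 2).
Proof.
move=> n0; have r1 := ratio_ge1 _ n0; have /andP[s0 _] := hs _ n0.
rewrite sqr_sqrtr ?mulr_ge0 ?ln_ge0// [2 * _]mulrC mulfK// lnK ?posrE ?(lt_le_trans ltr01)//.
by rewrite mulrCA divff ?mulr1// pnatr_eq0 -lt0n.
Qed.

Let level_ge (A : R) : \forall n \near \oo, A <= level n.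
Proof.
near=> n.
have n0 : (0 < n)%N by near: n; exact: nbhs_infty_gt.
have rA : expR (A ^+ 2 / 2) <= n%:R / (s n)%:R by near: n; exact: (cvgryPge _).1.
apply: (le_trans (ler_norm A)); rewrite -sqrtr_sqr ler_sqrt ?mulr_ge0 ?ln_ge0 ?ratio_ge1//.
rewrite -ler_ln ?posrE ?expR_gt0 ?(lt_le_trans ltr01 (ratio_ge1 _ n0))// in rA.
rewrite expRK in rA; lra.
Unshelve. all: end_near. Qed.

Let alpha_inv_le (delta : R) : 0 < delta ->
  \forall n \near \oo, (alpha n)^-1 <= expR (delta * level n / 2).
Proof.
move=> d0.
have d2 : 0 < delta / 2 by rewrite divr_gt0.
near=> n.
have n0 : (0 < n)%N by near: n; exact: nbhs_infty_gt.
have /andP[a0 a1] := halpha _ n0.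
have : `|ln (1 / alpha n)| <= delta / 2 * `|Num.sqrt (ln (n%:R / (s n)%:R))|.
  by near: n; have /eqoP/(_ _ d2) := hlogalpha.
rewrite div1r [X in _ <= _ * X]ger0_norm ?sqrtr_ge0// => H.
rewrite -[leLHS]lnK ?posrE ?invr_gt0// ler_expR.
apply: (le_trans (ler_norm _)); apply: (le_trans H).
rewrite mulrAC ler_pM2r// ?invr_gt0// ler_pM2l//.
have l0 : 0 <= ln (n%:R / (s n)%:R) :> R by rewrite ln_ge0// ratio_ge1.
by rewrite ler_sqrt ?mulr_ge0//; lra.
Unshelve. all: end_near. Qed.

(** [delta] and [K] are fixed first, as functions of [e] alone: [delta] makes
    T(b - delta) close to T(b) by the Lipschitz bound, and [K] makes the
    probability of stopping early small.  All other conditions of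
    [gbs_risk_finite] then hold for large n, since [level n] and [s n] tend to
    infinity and log (1 / alpha) <= delta a / 2 eventually. *)
Lemma gbs_risk_asymptotic (e : R) : 0 < e ->
  \forall n \near \oo, (risk_gbs n <= (std_normal_tail b + e)%:E)%E.
Proof.
move=> e0; have c0 : 0 < c by exact: peak_gt0.
pose delta := e / (4 * c).
have d0 : 0 < delta by apply: divr_gt0 => //; exact: mulr_gt0.
(* 4 exp (- K / 2) <= 8 / K <= e / 4 by exp (- x) <= 1 / x, and 8 <= K makes
   the geometric series of [gbs_risk_le] summable *)
pose K := 32 / e + 8; have e32 : 0 < 32 / e by rewrite divr_gt0.
have K8 : 8 <= K by rewrite /K lerDr ltW.
have Ke : expR (- (K / 2)) <= 2 / K.
  by rewrite -[2 / K]invf_div; apply: expR_le_inv; lra.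
have K32 : 32 <= K * e by rewrite /K mulrDl divfK ?gt_eqF// lerDl mulr_ge0// ltW.
have Kinv : 2 / K <= e / 16 by rewrite ler_pdivrMr; lra.
have Kinv8 : 2 / K <= 4^-1 by rewrite ler_pdivrMr; lra.
have tb : std_normal_tail (b - delta) <= std_normal_tail b + e / 4.
  have := std_normal_tail_lipschitz (b - delta) b; rewrite gerBl (ltW d0) => /(_ isT).
  rewrite (_ : c * (b - (b - delta)) = e / 4); first lra.
  by rewrite /delta; field; rewrite (gt_eqF c0).
clearbody delta.
set tl := std_normal_tail (delta - b); have tl0 : 0 < tl by exact: std_normal_tail_gt0.
near=> n.
have n0 : (0 < n)%N by near: n; exact: nbhs_infty_gt.
have ha := halpha _ n0; have ss := hs _ n0; have /andP[s0 _] := ss.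
have a0 : 0 < alpha n by case/andP: ha.
have [al2 ale] : alpha n <= 2^-1 /\ alpha n <= e / 16.
  have : `|alpha n| <= Num.min 2^-1 (e / 16).
    near: n; apply: cvgr0_norm_le => //.
    by rewrite lt_min invr_gt0 ltr0n divr_gt0.
  by rewrite gtr0_norm// le_min => /andP[].
have l1 : `|b| + 1 <= level n by near: n; exact: level_ge.
have l2 : (4 * K / c + delta * (`|b| + 1) + (`|b| + 1) ^+ 2 / 2) / (delta / 2) <= level n.
  by near: n; exact: level_ge.
have l3 : (8 * K / tl) / (delta / 2) <= level n by near: n; exact: level_ge.
have s1 : 2 * K / tl <= (s n)%:R.
  have : (Num.truncn (2 * K / tl) < s n)%N by near: n; exact: (cvgnyPgt _).1.
  move=> st; apply: ltW; apply: lt_le_trans (truncnS_gt _) _.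
  by rewrite ler_nat.
have ainv : (alpha n)^-1 <= expR (delta * level n / 2) by near: n; exact: alpha_inv_le.
rewrite ler_pdivrMr ?divr_gt0// in l2.
rewrite ler_pdivrMr ?divr_gt0// in l3.
have c2 : K * (4 * expR (- (delta * level n / 2)) + (s n)%:R^-1) <= tl.
  have sR : 0 < (s n)%:R :> R by rewrite ltr0n.
  have K0 : 0 < K by lra.
  have l30 : 0 < 8 * K / tl by rewrite divr_gt0// mulr_gt0.
  have dl : 8 * K / tl <= delta * level n / 2 by lra.
  have E1 : expR (- (delta * level n / 2)) <= tl / (8 * K).
    apply: (le_trans (expR_le_inv _ (lt_le_trans l30 dl))).
    by rewrite -[leRHS]invf_div lef_pV2// posrE (lt_le_trans l30).
  have S1 : (s n)%:R^-1 <= tl / (2 * K).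
    by rewrite -[leRHS]invf_div lef_pV2// posrE// divr_gt0// mulr_gt0.
  apply: (@le_trans _ _ (K * (4 * (tl / (8 * K)) + tl / (2 * K)))).
    by rewrite ler_pM2l// lerD// ler_pM2l.
  rewrite le_eqVlt; apply/orP; left; apply/eqP; field; rewrite gt_eqF//.
apply: ge_ereal_sup => _ [theta [Ss hm] <-].
apply: le_trans (gbs_risk_finite (eps n) (heps n) (alpha n) (level n) b delta K (s n) theta
  ha al2 ss (levelE _ n0) d0 _ _ l1 ainv _ c2 Ss hm) _; [lra|lra|lra|].
by rewrite lee_fin; lra.
Unshelve. all: end_near. Qed.

Lemma minimax_risk_asymptotic (e : R) : 0 < e ->
  \forall n \near \oo, ((std_normal_tail b - e)%:E <= risk_minimax n)%E.
Proof.
move=> e0; have c0 : 0 < c by exact: peak_gt0.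
pose delta := e / (2 * c).
have d0 : 0 < delta by apply: divr_gt0 => //; exact: mulr_gt0.
have tb : std_normal_tail b - e / 2 <= std_normal_tail (b + delta).
  have := std_normal_tail_lipschitz b (b + delta); rewrite lerDl (ltW d0) => /(_ isT).
  rewrite (_ : c * (b + delta - b) = e / 2); first lra.
  by rewrite /delta; field; rewrite (gt_eqF c0).
clearbody delta.
pose Y := 8 / (e * (delta * c)).
have Y0 : 0 < Y by rewrite divr_gt0// !mulr_gt0.
near=> n.
have n0 : (0 < n)%N by near: n; exact: nbhs_infty_gt.
have /andP[s0 _] := hs _ n0.
have r4 : 4 <= n%:R / (s n)%:R :> R by near: n; exact: (cvgryPge _).1.
have l1 : delta <= level n by near: n; exact: level_ge.
have l2 : 1 - b <= level n by near: n; exact: level_ge.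
have l3 : (Y + delta ^+ 2 / 8) / (delta / 2) <= level n by near: n; exact: level_ge.
rewrite ler_pdivrMr ?divr_gt0// in l3.
have y0 : Y <= delta * level n / 2 - delta ^+ 2 / 8 by lra.
apply: le_trans (minimax_risk_ge_finite (eps n) (heps n) (level n) b delta (s n) s0 _ erefl
  (levelE _ n0) d0 l1 _ (lt_le_trans Y0 y0)); last 2 first.
- by rewrite -ler_pdivlMr// ltr0n.
- lra.
rewrite lee_fin.
have : (delta * c / 4 * (delta * level n / 2 - delta ^+ 2 / 8))^-1 <= e / 2.
  have dc : 0 < delta * c / 4 by apply: divr_gt0 => //; exact: mulr_gt0.
  have Y1 := lt_le_trans Y0 y0.
  rewrite -[leRHS]invf_div lef_pV2 ?posrE; last 2 first.
  - exact: mulr_gt0.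
  - exact: divr_gt0.
  have -> : 2 / e = delta * c / 4 * Y.
    by rewrite /Y; field; rewrite ?(gt_eqF c0) ?(gt_eqF d0) ?(gt_eqF e0).
  by rewrite (ler_pM2l dc).
lra.
Unshelve. all: end_near. Qed.

Lemma minimax_le_gbs n : (0 < n)%N -> (risk_minimax n <= risk_gbs n)%E.
Proof.
move=> n0; apply: ereal_inf_lbound; exists (gbs (alpha n)) => //.
exact: measurable_gbs (halpha _ n0).
Qed.

End asymptotics.

Lemma squeeze_up_to_o1 (R : realType) (u v : nat -> \bar R) (l : R) :
  (forall e, 0 < e -> \forall n \near \oo, (u n <= (l + e)%:E)%E) ->
  (forall e, 0 < e -> \forall n \near \oo, ((l - e)%:E <= v n)%E) ->
  (\forall n \near \oo, (v n <= u n)%E) ->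
  [/\ le_up_to_o1 u (fun=> l%:E), eq_up_to_o1 u v & eq_up_to_o1 u (fun=> l%:E)].
Proof.
move=> ul lv vu.
have fin : \forall n \near \oo, u n \is a fin_num /\ v n \is a fin_num.
  near=> n.
  have un : (u n <= (l + 1)%:E)%E by near: n; exact: ul.
  have vn : ((l - 1)%:E <= v n)%E by near: n; exact: lv.
  have vun : (v n <= u n)%E by near: n.
  split; rewrite fin_numE; apply/andP; split.
  - by rewrite gt_eqF// (lt_le_trans (ltNyr (l - 1)))// (le_trans vn).
  - by rewrite lt_eqF// (le_lt_trans un)// ltry.
  - by rewrite gt_eqF// (lt_le_trans (ltNyr (l - 1))).
  - by rewrite lt_eqF// (le_lt_trans vun)// (le_lt_trans un)// ltry.
have close e : 0 < e -> \forall n \near \oo, l - e <= fine (v n) /\ fine (v n) <= fine (u n) /\ fine (u n) <= l + e.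
  move=> e0; near=> n.
  have [uf vf] : u n \is a fin_num /\ v n \is a fin_num by near: n.
  by rewrite -!lee_fin !fineK//; split; [|split]; near: n; [exact: lv|exact: vu|exact: ul].
have eqR : eq_up_to_o1 u (fun=> l%:E).
  exists (fun n => fine (u n) - l).
    apply/cvgr0Pnorm_le => e e0; near=> n.
    have [? [? ?]] : l - e <= fine (v n) /\ fine (v n) <= fine (u n) /\ fine (u n) <= l + e.
      by near: n; exact: close.
    by rewrite ler_norml; apply/andP; split; lra.
  near=> n; have [uf vf] : u n \is a fin_num /\ v n \is a fin_num by near: n.
  by rewrite -EFinD addrC subrK fineK.
split => //.
- case: eqR => r r0 ur; exists r => //; near=> n.
  have -> : u n = (l%:E + (r n)%:E)%E by near: n.
  exact: lexx.
- exists (fun n => fine (u n) - fine (v n)).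
    apply/cvgr0Pnorm_le => e e0.
    have e2 : 0 < e / 2 by rewrite divr_gt0.
    near=> n.
    have [? [? ?]] : l - e / 2 <= fine (v n) /\ fine (v n) <= fine (u n) /\ fine (u n) <= l + e / 2.
      by near: n; exact: close.
    by rewrite ler_norml; apply/andP; split; lra.
  near=> n; have [uf vf] : u n \is a fin_num /\ v n \is a fin_num by near: n.
  by rewrite -[in RHS](fineK vf) -EFinD addrC subrK fineK.
Unshelve. all: end_near. Qed.

Theorem theorem1 (R : realType)
  (d : nat -> measure_display) (Omega : forall n : nat, measurableType (d n))
  (P : forall n : nat, probability (Omega n) R)
  (eps : forall n : nat, 'I_n -> {RV (P n) >-> R})
  (s : nat -> nat) (alpha : nat -> R) (b : R)
  (heps : forall n : nat, iid_std_normal (eps n))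
  (hs : forall n : nat, (0 < n)%N -> (0 < s n <= n)%N)
  (halpha : forall n : nat, (0 < n)%N -> 0 < alpha n < 1)
  (hs_infty : s n @[n --> \oo] --> \oo)
  (hns_infty : (n%:R / (s n)%:R : R) @[n --> \oo] --> +oo)
  (halpha0 : alpha n @[n --> \oo] --> (0 : R))
  (hlogalpha : (fun n : nat => ln (1 / alpha n)) =o_\oo
               (fun n : nat => Num.sqrt (ln (n%:R / (s n)%:R)))) :
  let risk_gbs := fun n : nat =>
    sup_risk (P n) (fun i => eps n i) (s n) b (gbs (alpha n)) in
  let risk_minimax := fun n : nat =>
    minimax_risk (P n) (fun i => eps n i) (s n) b in
  let limit_risk := fun _ : nat => (std_normal_tail b)%:E in
  [/\ le_up_to_o1 risk_gbs limit_risk,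
      eq_up_to_o1 risk_gbs risk_minimax
    & eq_up_to_o1 risk_gbs limit_risk].
Proof.
move=> risk_gbs risk_minimax limit_risk; apply: squeeze_up_to_o1.
- exact: gbs_risk_asymptotic.
- exact: minimax_risk_asymptotic.
- near=> n; have n0 : (0 < n)%N by near: n; exact: nbhs_infty_gt.
  exact: minimax_le_gbs.
Unshelve. all: end_near. Qed.
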